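(* Let $L>0$, $0\le\mu<L$, $N\ge1$, put $q=\mu/L$, $\bar q=1-q$, and let $w=(w_x,w_f,w_g)$ satisfy $w_x,w_f,w_g\ge0$, $w_x+w_f+w_g=1$. Let $\eta>0$ satisfy $r_{\eta,w}\in\mathcal O_N(q)$ and $H_w(\eta)\ge0$. For every $D_0>0$, the certificate and initial-condition data $(\Phi,B_x,B_f,B_g)$ of the candidate chain $\mathcal C_{w,\eta,D_0}$ satisfy $$\Phi=\eta\,(w_xB_x+w_fB_f+w_gB_g)+2H_w(\eta)\,\gamma_0(D_0-\gamma_0).$$ Consequently, for every $R>0$ and every $d\ge2N+1$, $$\mathscr R_N\bigl(\mathcal P^{\mu,L}_{w,R}(\mathbb R^d)\bigr)\ \ge\ \frac L2\,\eta R^2 .$$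
   Context: **Problem class and risk.** $\mathcal F_{\mu,L}(\mathbb R^d)$: differentiable $\mu$-strongly convex functions $f:\mathbb R^d\to\mathbb R$ with $L$-Lipschitz gradient. An instance is $(\mathcal O_f,x_0)$ with $f\in\mathcal F_{\mu,L}(\mathbb R^d)$ attaining its minimum $f_*$, $\mathcal O_f(x)=(f(x),\nabla f(x))$, $x_0\in\mathbb R^d$. $\mathcal P^{\mu,L}_{w,R}(\mathbb R^d)$ is the set of instances such that for some $x_*\in\operatorname{argmin}f$, $w_x\|x_0-x_*\|^2+\frac{2w_f}{L}(f(x_0)-f_* )+\frac{w_g}{L^2}\|\nabla f(x_0)\|^2\le R^2$. $\mathcal A_{N,d}$ is the set of deterministic first-order methods that may depend on the class parameters and $(N,d)$, query first at $x_0$, make at most $N$ adaptive oracle calls, and return an arbitrary function of the history of oracle answers; $\mathscr R_N(\mathcal P)=\inf_{\mathcal M\in\mathcal A_{N,d}}\sup_{(\mathcal O_f,x_0)\in\mathcal P}(f(\mathcal M(\mathcal O_f,x_0))-f_* )$. **Paired backward sequence.** Given $r\in(0,1)$ set $a_N=r$, $b_N=\sqrt{\bar q}\,r$, and for $k=N,\dots,2$, as long as well defined (radicand nonnegative), $c_k=\sqrt{(1-a_k)(1+\bar q+qa_k)}$, $d_k=\bar q+qa_k$, $a_{k-1}=d_ka_k+c_kb_k$, $b_{k-1}=-qc_ka_k+d_kb_k$. The sequence is ordered if it is well defined through $k=1$ and $1>a_1>\dots>a_N>0$, $b_1>0$; $\mathcal O_N(q)$ is the set of $r\in(0,1)$ whose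 sequence is ordered. **Induced radius, residual, boundary data.** $r_{\eta,w}^2=q+\eta(\bar qw_x-qw_f)$; when positive, $r_{\eta,w}$ is its positive square root. For $r_{\eta,w}\in\mathcal O_N(q)$ let $((a_k,b_k))_{k=1}^N$ be the backward sequence associated with $r_{\eta,w}$, set $H_w(\eta)=1-a_1-\eta(w_x+w_f)-\sqrt{\eta/\bar q}\,b_1$, and $c_1=b_1+\sqrt{\bar q\eta}$. **Candidate chain.** Fix $D_0>0$. For $0\le k<N$, once $D_k$ is defined, $\gamma_k=\frac{b_{k+1}}{c_{k+1}}D_k$, $\delta_k=a_{k+1}D_k+(1-a_{k+1})\gamma_k$; for $0\le k<N-1$, $D_{k+1}=\bigl[\frac{c_{k+2}}{b_{k+2}}(\gamma_k-q\delta_k)(D_k-\gamma_k)\bigr]^{1/2}$; at the end, $D_N=\bigl[\frac{(\gamma_{N-1}-q\delta_{N-1})(D_{N-1}-\gamma_{N-1})}{a_N}\bigr]^{1/2}$, $\gamma_N=a_ND_N$. (Under the hypotheses of the claim this is well defined.) The output is $\mathcal C_{w,\eta,D_0}=((D_k)_{k=0}^N,(\gamma_k)_{k=0}^N,(\delta_k)_{k=0}^{N-1})$. **Certificate and initial-condition data.** $$\Phi=D_N^2-\frac{(D_N-\gamma_N)^2+q\sum_{\ell=0}^{N-1}(D_\ell-\delta_\ell)^2}{\bar q},\quad B_x=\sum_{\ell=0}^ND_\ell^2,\quad B_f=D_0^2-\frac{(D_0-\gamma_0)^2+q\sum_{\ell=1}^ND_\ell^2}{\bar q},\quad B_g=\gamma_0^2.$$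 *)

(* Defs.v *)
From HB Require Import structures.
From mathcomp Require Import all_boot all_order all_algebra.
From mathcomp Require Import all_classical all_reals all_analysis.

Set Implicit Arguments.
Unset Strict Implicit.
Unset Printing Implicit Defensive.

Import Order.TTheory GRing.Theory Num.Theory.
Import numFieldNormedType.Exports.

Local Open Scope classical_set_scope.
Local Open Scope ring_scope.

(* The library norm `|x| on 'rV[R]_d is the sup norm, so the Euclidean norm is
   defined separately. Differentiability does not depend on this choice. *)
Definition l2norm (R : realType) (d : nat) (x : 'rV[R]_d) : R :=
  Num.sqrt (\sum_(i < d) x 0 i ^+ 2).

Definition gradient (R : realType) (d : nat) (f : 'rV[R]_d -> R)
    (x : 'rV[R]_d) : 'rV[R]_d :=
  \row_(i < d) 'D_(delta_mx 0 i : 'rV[R]_d) f x.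

Definition strongly_convex (R : realType) (d : nat) (mu : R)
    (f : 'rV[R]_d -> R) : Prop :=
  forall (x y : 'rV[R]_d) (t : R), 0 <= t <= 1 ->
    f (t *: x + (1 - t) *: y) <=
      t * f x + (1 - t) * f y - mu / 2 * t * (1 - t) * l2norm (x - y) ^+ 2.

Definition smooth_class (R : realType) (d : nat) (mu L : R) :
    set ('rV[R]_d -> R) :=
  [set f | [/\ forall x, differentiable f x,
               strongly_convex mu f &
               forall x y,
                 l2norm (gradient f x - gradient f y) <= L * l2norm (x - y)]].

Definition argmin (R : realType) (d : nat) (f : 'rV[R]_d -> R) :
    set 'rV[R]_d :=
  [set x | forall y, f x <= f y].

Definition min_value (R : realType) (d : nat) (f : 'rV[R]_d -> R) : R :=
  inf (range f).

(* An instance (O_f, x0) is represented by (f, x0); methods only access f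
   through its oracle. *)
Definition problem_class (R : realType) (d : nat) (mu L wx wf wg rad : R) :
    set (('rV[R]_d -> R) * 'rV[R]_d) :=
  [set p | smooth_class mu L p.1 /\
     exists2 xs : 'rV[R]_d, argmin p.1 xs &
       wx * l2norm (p.2 - xs) ^+ 2
       + 2 * wf / L * (p.1 p.2 - min_value p.1)
       + wg / L ^+ 2 * l2norm (gradient p.1 p.2) ^+ 2 <= rad ^+ 2].

Definition oracle (R : realType) (d : nat) : Type :=
  'rV[R]_d -> R * 'rV[R]_d.

Definition first_order_oracle (R : realType) (d : nat)
    (f : 'rV[R]_d -> R) : oracle R d :=
  fun x => (f x, gradient f x).

(* Query points paired with the answers, oldest first. *)
Definition history (R : realType) (d : nat) : Type :=
  seq ('rV[R]_d * (R * 'rV[R]_d)).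

(* [next_query h = None] means that no further oracle call is made. *)
Record fo_algorithm (R : realType) (d : nat) := FoAlgorithm {
  next_query : history R d -> option 'rV[R]_d;
  output : history R d -> 'rV[R]_d
}.

Fixpoint extend_history (R : realType) (d : nat) (A : fo_algorithm R d)
    (O : oracle R d) (n : nat) (h : history R d) : history R d :=
  if n is n'.+1 then
    if next_query A h is Some x
    then extend_history A O n' (rcons h (x, O x)) else h
  else h.

(* The call at x0 is one of the N calls, hence at most N.-1 remain. *)
Definition run (R : realType) (d : nat) (N : nat) (A : fo_algorithm R d)
    (O : oracle R d) (x0 : 'rV[R]_d) : 'rV[R]_d :=
  output A (extend_history A O N.-1 [:: (x0, O x0)]).

Definition fo_methods (R : realType) (N d : nat) :
    set (oracle R d -> 'rV[R]_d -> 'rV[R]_d) :=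
  [set M | exists A : fo_algorithm R d, forall O x0, M O x0 = run N A O x0].

Definition minimax_risk (R : realType) (N d : nat)
    (P : set (('rV[R]_d -> R) * 'rV[R]_d)) : \bar R :=
  ereal_inf
    [set ereal_sup
       [set (p.1 (M (first_order_oracle p.1) p.2) - min_value p.1)%:E | p in P]
    | M in @fo_methods R N d].

Section BackwardSequence.
Context {R : realType}.
Implicit Types (q r a : R) (N k : nat).

Definition coef_d q a : R := (1 - q) + q * a.
Definition radicand q a : R := (1 - a) * (1 + (1 - q) + q * a).
Definition coef_c q a : R := Num.sqrt (radicand q a).

(* [backward q r j] is (a_(N-j), b_(N-j)). *)
Fixpoint backward q r (j : nat) : R * R :=
  if j is j'.+1 then
    let: (a, b) := backward q r j' in
    (coef_d q a * a + coef_c q a * b,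
     - q * coef_c q a * a + coef_d q a * b)
  else (r, Num.sqrt (1 - q) * r).

Definition seq_a q N r k : R := (backward q r (N - k)).1.
Definition seq_b q N r k : R := (backward q r (N - k)).2.

Definition ordered_set q N : set R :=
  [set r | [/\ 0 < r < 1,
     forall k, (2 <= k <= N)%N -> 0 <= radicand q (seq_a q N r k),
     1 > seq_a q N r 1,
     forall k, (1 <= k < N)%N -> seq_a q N r k > seq_a q N r k.+1 &
     seq_a q N r N > 0 /\ seq_b q N r 1 > 0]].

(* Equal to 0, hence outside [ordered_set], when the radicand is not
   positive. *)
Definition induced_radius q (wx wf eta : R) : R :=
  Num.sqrt (q + eta * ((1 - q) * wx - q * wf)).

Definition residual q N (wx wf eta : R) : R :=
  let r := induced_radius q wx wf eta in
  1 - seq_a q N r 1 - eta * (wx + wf)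
  - Num.sqrt (eta / (1 - q)) * seq_b q N r 1.

(* c_1 is set by the boundary data, not by the backward recursion. *)
Definition seq_c q N r (eta : R) k : R :=
  if k == 1%N then seq_b q N r 1 + Num.sqrt ((1 - q) * eta)
  else coef_c q (seq_a q N r k).

End BackwardSequence.

(* D_k and gamma_k are meaningful for k <= N, delta_k for k < N. *)
Record chain (R : realType) := Chain {
  chain_D : nat -> R;
  chain_gamma : nat -> R;
  chain_delta : nat -> R
}.

Section CandidateChain.
Context {R : realType}.
Implicit Types (q r eta : R) (N k : nat).

Definition gamma_of q N r eta k (Dk : R) : R :=
  seq_b q N r k.+1 / seq_c q N r eta k.+1 * Dk.

Definition delta_of q N r eta k (Dk : R) : R :=
  seq_a q N r k.+1 * Dk + (1 - seq_a q N r k.+1) * gamma_of q N r eta k Dk.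

(* The square of D_(k+1) as a function of D_k. *)
Definition next_sq q N r eta k (Dk : R) : R :=
  let g := gamma_of q N r eta k Dk in
  let dl := delta_of q N r eta k Dk in
  if k.+1 == N then (g - q * dl) * (Dk - g) / seq_a q N r N
  else seq_c q N r eta k.+2 / seq_b q N r k.+2 * (g - q * dl) * (Dk - g).

Fixpoint candidate_D q N r eta (D0 : R) k : R :=
  if k is k'.+1
  then Num.sqrt (next_sq q N r eta k' (candidate_D q N r eta D0 k'))
  else D0.

Definition candidate_chain q N (wx wf eta D0 : R) : chain R :=
  let r := induced_radius q wx wf eta in
  let D := candidate_D q N r eta D0 in
  Chain D
    (fun k => if k == N then seq_a q N r N * D N
              else gamma_of q N r eta k (D k))
    (fun k => delta_of q N r eta k (D k)).

(* Every denominator occurring in the construction of the chain is nonzero and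
   every radicand is nonnegative. *)
Definition candidate_chain_well_defined q N (wx wf eta D0 : R) : Prop :=
  let r := induced_radius q wx wf eta in
  [/\ forall k, (k < N)%N -> seq_c q N r eta k.+1 != 0,
      forall k, (k < N.-1)%N -> seq_b q N r k.+2 != 0,
      seq_a q N r N != 0 &
      forall k, (k < N)%N ->
        0 <= next_sq q N r eta k (candidate_D q N r eta D0 k)].

Definition cert_Phi q N (C : chain R) : R :=
  chain_D C N ^+ 2
  - ((chain_D C N - chain_gamma C N) ^+ 2
     + q * \sum_(0 <= l < N) (chain_D C l - chain_delta C l) ^+ 2) / (1 - q).

Definition init_Bx N (C : chain R) : R :=
  \sum_(0 <= l < N.+1) chain_D C l ^+ 2.

Definition init_Bf q N (C : chain R) : R :=
  chain_D C 0 ^+ 2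
  - ((chain_D C 0 - chain_gamma C 0) ^+ 2
     + q * \sum_(1 <= l < N.+1) chain_D C l ^+ 2) / (1 - q).

Definition init_Bg (C : chain R) : R := chain_gamma C 0 ^+ 2.

End CandidateChain.

(* Main.v *)
Require Import Defs.
From HB Require Import structures.
From mathcomp Require Import all_boot all_order all_algebra.
From mathcomp Require Import all_classical all_reals all_analysis.
From mathcomp Require Import ring lra.

Set Implicit Arguments.
Unset Strict Implicit.
Unset Printing Implicit Defensive.

Import Order.TTheory GRing.Theory Num.Theory.
Import numFieldNormedType.Exports.

Local Open Scope classical_set_scope.
Local Open Scope ring_scope.

(* With [L = 1] and [y = x - x_*], put
     y_0 = sum_(l <= N) D_l e_l,
     s_j = gamma_j e_j + q sum_(l < j) delta_l e_l - q y_0   (j <= N),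
   for an orthonormal system [e_0, ..., e_N], and let [S] be the convex hull of
   [0] and the [s_j]. The hard function is
     f(y) = q/2 |y|^2 + max_(s in S) (<s, y> - |s|^2 / (2 (1 - q))),
   whose gradient at [y] is [q y] plus the projection of [(1 - q) y] onto [S];
   it lies in the class, is minimal at [0] with value [0], and any point [y]
   with [<e_N, y - y_0> = 0] has [f(y) >= Phi / 2], by the single slope [s_N].
   The step relation [gamma_(k+1) D_(k+1) = (gamma_k - q delta_k)(D_k - gamma_k)]
   makes the projection at [y_0 + u], for [u] orthogonal to [e_k, ..., e_N] and
   [k < N], a convex combination of [s_0, ..., s_k] only; the vertex [0] is
   excluded because some convex combination of the [s_j] is a nonnegative
   multiple of [e_N], and this is where [H_w(eta) >= 0] enters. The answer to
   such a query therefore depends on [e_0, ..., e_k] alone, so an adversary can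
   choose each new [e_(k+1)] after seeing the next query; dimension [2 N + 1]
   leaves room to keep [e_N] orthogonal to the displacement of the output.
   The identity for [Phi] telescopes the quantity
   [2 (1 - a_(k+1)) (gamma_k - q delta_k) (D_k - gamma_k)]. *)

(** * The backward sequence *)

Lemma backward_ind (N : nat) (P : nat -> Prop) : P N ->
  (forall k, (1 <= k < N)%N -> P k.+1 -> P k) ->
  forall k, (1 <= k <= N)%N -> P k.
Proof.
move=> PN PS k /andP[k1 kN].
rewrite -(subKn kN); have : (N - k < N)%N by rewrite ltn_subrL k1 (leq_trans k1).
elim: (N - k)%N => [|j IH] jN; first by rewrite subn0.
apply: PS; first by rewrite subn_gt0 jN ltn_subrL (leq_ltn_trans _ jN).
by rewrite subnSK ?(ltnW jN)//; apply: IH; exact: ltnW.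
Qed.

Section OrderedSequence.
Context {R : realType} {q r : R} {N : nat}.
Hypotheses (q0 : 0 <= q) (q1 : q < 1).
Hypothesis hr : ordered_set q N r.

Local Notation a := (seq_a q N r).
Local Notation b := (seq_b q N r).
Local Notation c k := (coef_c q (a k)).
Local Notation d k := (coef_d q (a k)).

Lemma seq_ab_step k : (k < N)%N ->
  a k = d k.+1 * a k.+1 + c k.+1 * b k.+1 /\
  b k = - q * c k.+1 * a k.+1 + d k.+1 * b k.+1.
Proof.
move=> kN; rewrite /seq_a /seq_b -(subnSK kN) /=.
by case: (backward _ _ _).
Qed.

Lemma seq_a_last : a N = r.
Proof. by rewrite /seq_a subnn. Qed.

Lemma seq_b_last : b N = Num.sqrt (1 - q) * r.
Proof. by rewrite /seq_b subnn. Qed.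

Lemma seq_a_lt1 k : (1 <= k <= N)%N -> a k < 1.
Proof.
have [_ _ a1 adec _] := hr.
elim: k => [|k IH]; first by [].
case: k IH => [|k] IH /andP[_ kN]; first exact: a1.
by apply: lt_trans (adec k.+1 kN) (IH _); exact: ltnW kN.
Qed.

Lemma seq_a_gt0 k : (1 <= k <= N)%N -> 0 < a k.
Proof.
have [_ _ _ adec [aN _]] := hr; move: k; apply: backward_ind => // k hk IH.
exact: lt_trans (adec k hk).
Qed.

Lemma coef_d_gt0 k : (1 <= k <= N)%N -> 0 < d k.
Proof.
move=> /seq_a_gt0 ak; rewrite /coef_d ltr_wpDr ?subr_gt0//.
by rewrite mulr_ge0// ltW.
Qed.

Lemma radicand_gt0 k : (1 <= k <= N)%N -> 0 < radicand q (a k).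
Proof.
move=> hk; have dk := coef_d_gt0 hk; have ak := seq_a_lt1 hk.
by rewrite mulr_gt0 ?subr_gt0// -addrA addr_gt0.
Qed.

Lemma coef_c_sq k : (1 <= k <= N)%N -> c k ^+ 2 = radicand q (a k).
Proof. by move=> hk; rewrite sqr_sqrtr// ltW// radicand_gt0. Qed.

Lemma coef_c_gt0 k : (1 <= k <= N)%N -> 0 < c k.
Proof. by move=> hk; rewrite sqrtr_gt0 radicand_gt0. Qed.

(* The backward step is a rotation for the quadratic form [q a^2 + b^2],
   since [d^2 + q c^2 = 1]. *)
Lemma coef_dc k : (1 <= k <= N)%N -> d k ^+ 2 + q * c k ^+ 2 = 1.
Proof. by move=> hk; rewrite coef_c_sq// /coef_d /radicand; ring. Qed.

(** The rotation preserves the form, and at [k = N] its value is [q r^2 + (1 - q) r^2]. *)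
Lemma seq_ab_norm k : (1 <= k <= N)%N -> q * a k ^+ 2 + b k ^+ 2 = r ^+ 2.
Proof.
move: k; apply: backward_ind => [|k /andP[k1 kN] IH].
  by rewrite seq_a_last seq_b_last exprMn sqr_sqrtr ?subr_ge0 ?(ltW q1)//; ring.
have [-> ->] := seq_ab_step kN.
transitivity ((d k.+1 ^+ 2 + q * c k.+1 ^+ 2) *
              (q * a k.+1 ^+ 2 + b k.+1 ^+ 2)); first ring.
by rewrite coef_dc ?IH ?mul1r// kN.
Qed.

(** Only [b_1 > 0] is given. Inverting the rotation writes [b_(k+1)] as [q c a_k + d b_k], with
    nonnegative coefficients, so positivity moves forward from [k = 1]. *)
Lemma seq_b_gt0 k : (1 <= k <= N)%N -> 0 < b k.
Proof.
have [_ _ _ _ [_ b1]] := hr.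
elim: k => [|k IH]; first by [].
case: k IH => [|k] IH /andP[_ kN]; first exact: b1.
have hk : (1 <= k.+1 <= N)%N by exact: ltnW kN.
have [Ea Eb] := seq_ab_step kN.
have -> : b k.+2 = q * c k.+2 * a k.+1 + d k.+2 * b k.+1.
  rewrite Ea Eb; transitivity ((d k.+2 ^+ 2 + q * c k.+2 ^+ 2) * b k.+2).
    by rewrite coef_dc ?mul1r.
  by ring.
rewrite ltr_wpDl ?mulr_ge0 ?mulr_gt0 ?IH ?coef_d_gt0//.
- exact/ltW/coef_c_gt0.
- exact/ltW/seq_a_gt0.
Qed.

(* Otherwise [a_k = d a + c b >= d a + c^2 >= 1]. *)
Lemma seq_b_lt_c k : (1 <= k < N)%N -> b k.+1 < c k.+1.
Proof.
move=> /andP[k1 kN]; have hS : (1 <= k.+1 <= N)%N by [].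
have [Ea _] := seq_ab_step kN.
have ak : a k < 1 by apply: seq_a_lt1; rewrite k1 ltnW.
rewrite ltNge; apply/negP => cb.
have c0 := coef_c_gt0 hS; have cc := coef_c_sq hS.
have cbc : c k.+1 ^+ 2 <= c k.+1 * b k.+1 by rewrite expr2 ler_pM2l.
have aS := seq_a_lt1 hS.
have : 0 <= (1 - q) * (1 - a k.+1) ^+ 2 by rewrite mulr_ge0 ?sqr_ge0// subr_ge0 ltW.
move: Ea cc; rewrite /coef_d /radicand; nra.
Qed.

End OrderedSequence.

(** * The candidate chain *)

(* [hc_mult] provides weights [beta_i = m_i - m_(i+1)] ([beta_N = m_N]) of a
   convex combination of the slopes [s_i] below that is a nonnegative multiple
   of the last basis vector. *)
Record hard_chain (R : realType) (q : R) (N : nat) (D g dl m : nat -> R) :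
    Prop := HardChain {
  hc_D_gt0 : forall k, (k <= N)%N -> 0 < D k;
  hc_g_gt0 : forall k, (k <= N)%N -> 0 < g k;
  hc_g_le : forall k, (k <= N)%N -> g k <= D k;
  hc_slope : forall k, (k < N)%N -> 0 < g k - q * dl k;
  hc_step : forall k, (k < N)%N ->
    g k.+1 * D k.+1 = (g k - q * dl k) * (D k - g k);
  hc_mult0 : m 0%N = 1;
  hc_mult : forall k, (k < N)%N ->
    m k.+1 * (g k - q * dl k) = m k * g k - q * D k;
  hc_mult_dec : forall k, (k < N)%N -> m k.+1 <= m k;
  hc_mult_ge0 : 0 <= m N;
  hc_mult_last : q * D N <= m N * g N
}.

Section CandidateChainTheory.
Context {R : realType} {q wx wf wg eta : R} {N : nat}.
Hypotheses (q0 : 0 <= q) (q1 : q < 1) (hN : (1 <= N)%N).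
Hypotheses (hwx : 0 <= wx) (heta : 0 < eta).

Local Notation r := (induced_radius q wx wf eta).
Hypothesis hr : ordered_set q N r.
Hypothesis hH : 0 <= residual q N wx wf eta.

Local Notation a := (seq_a q N r).
Local Notation b := (seq_b q N r).
Local Notation c := (seq_c q N r eta).
Local Notation s := (Num.sqrt ((1 - q) * eta)).

Let q'0 : 0 < 1 - q. Proof. by rewrite subr_gt0. Qed.

Let s_gt0 : 0 < s. Proof. by rewrite sqrtr_gt0 mulr_gt0. Qed.

Let sqr_s : s ^+ 2 = (1 - q) * eta.
Proof. by rewrite sqr_sqrtr// mulr_ge0 ?ltW. Qed.

Lemma induced_radius_gt0 : 0 < r.
Proof. by case: hr => /andP[]. Qed.

Lemma induced_radius_sq : r ^+ 2 = q + eta * ((1 - q) * wx - q * wf).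
Proof. by rewrite sqr_sqrtr// ltW// -sqrtr_gt0 induced_radius_gt0. Qed.

Lemma sqrt_eta_div : Num.sqrt (eta / (1 - q)) = s / (1 - q).
Proof.
have -> : eta / (1 - q) = (1 - q) * eta / (1 - q) ^+ 2.
  by field; rewrite gt_eqF.
by rewrite sqrtrM ?mulr_ge0 ?ltW// sqrtrV ?exprn_ge0 ?ltW// sqrtr_sqr gtr0_norm.
Qed.

Lemma residualE : (1 - q) * residual q N wx wf eta =
  (1 - q) * (1 - a 1%N) - s ^+ 2 * (wx + wf) - s * b 1%N.
Proof.
by rewrite /residual sqrt_eta_div sqr_s; field; rewrite gt_eqF.
Qed.

Let h1 : (1 <= 1 <= N)%N. Proof. by []. Qed.

(** The right side exceeds the left by exactly [q (1 - q)] times the residual plus [s^2 wx]. The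
    sign of the first slope and that of the multipliers both rest on this bound. *)
Lemma boundary_ineq : q * s * b 1%N <= (1 - q) * (r ^+ 2 - q * a 1%N).
Proof.
have H : 0 <= q * ((1 - q) * residual q N wx wf eta).
  by rewrite !mulr_ge0// ltW.
have S : 0 <= s ^+ 2 * wx by rewrite mulr_ge0// sqr_ge0.
rewrite residualE sqr_s in H; rewrite sqr_s in S; rewrite induced_radius_sq.
nra.
Qed.

(** Since [a_1 < 1], [r^2 - q a_1 <= r^2 - q a_1^2 = b_1^2]; insert this in [boundary_ineq] and
    divide by [b_1]. *)
Lemma boundary_slope_ge0 : q * s <= (1 - q) * b 1%N.
Proof.
have b1 := seq_b_gt0 q0 q1 hr h1.
rewrite -(ler_pM2r b1) (le_trans boundary_ineq)// -mulrA ler_pM2l//.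
rewrite -(seq_ab_norm q0 q1 hr h1) -expr2 addrAC gerDr.
have a0 := seq_a_gt0 hr h1; have a1 := seq_a_lt1 hr h1.
by rewrite -mulrBr mulr_ge0_le0// subr_le0 expr2 ger_pMl// ltW.
Qed.

(** The ratio [(gamma_k - q delta_k) / D_k] multiplied by [c_(k+1)]. For [k >= 1] the backward
    recursion collapses it to [b_k]. *)
Definition seq_slope k :=
  coef_d q (a k.+1) * b k.+1 - q * a k.+1 * c k.+1.

Lemma seq_c1 : c 1%N = b 1%N + s. Proof. by []. Qed.

Lemma seq_cS k : c k.+2 = coef_c q (a k.+2). Proof. by []. Qed.

Lemma seq_slope0 : seq_slope 0 = (1 - q) * b 1%N - q * a 1%N * s.
Proof. by rewrite /seq_slope seq_c1 /coef_d; ring. Qed.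

Lemma seq_slopeS k : (k.+1 < N)%N -> seq_slope k.+1 = b k.+1.
Proof.
move=> kN; have [_ ->] := seq_ab_step (q := q) (r := r) kN.
by rewrite /seq_slope seq_cS; ring.
Qed.

Lemma seq_b_lt_seq_c k : (1 <= k <= N)%N -> b k < c k.
Proof.
case: k => [|[|k]]; first by [].
  by rewrite seq_c1 ltrDl.
by move=> hk; rewrite seq_cS; apply: (seq_b_lt_c q0 q1 hr).
Qed.

Lemma seq_c_gt0 k : (1 <= k <= N)%N -> 0 < c k.
Proof.
by move=> hk; apply: lt_trans (seq_b_lt_seq_c hk); exact: (seq_b_gt0 q0 q1).
Qed.

(** Only [k = 0] needs the boundary data: [q a_1 s <= (1 - q) b_1 a_1 < (1 - q) b_1]. *)
Lemma seq_slope_gt0 k : (k < N)%N -> 0 < seq_slope k.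
Proof.
case: k => [_|k kN]; last first.
  by rewrite seq_slopeS//; apply: (seq_b_gt0 q0 q1 hr); exact: ltnW kN.
have b1 := seq_b_gt0 q0 q1 hr h1.
have a0 := seq_a_gt0 hr h1; have a1 := seq_a_lt1 hr h1.
rewrite seq_slope0 subr_gt0 mulrAC.
apply: (@le_lt_trans _ _ ((1 - q) * b 1%N * a 1%N)).
  by rewrite ler_pM2r// boundary_slope_ge0.
by rewrite gtr_pMr// mulr_gt0.
Qed.

Section Chain.
Context {D0 : R}.
Hypothesis hD0 : 0 < D0.

Local Notation D := (candidate_D q N r eta D0).
Local Notation g k := (gamma_of q N r eta k (D k)).
Local Notation dl k := (delta_of q N r eta k (D k)).

Lemma gamma_ofE k : g k = b k.+1 / c k.+1 * D k. Proof. by []. Qed.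

Lemma gap_ofE k : (k < N)%N -> D k - g k = (c k.+1 - b k.+1) / c k.+1 * D k.
Proof. by move=> kN; rewrite gamma_ofE; field; rewrite gt_eqF// seq_c_gt0. Qed.

Lemma slope_ofE k : (k < N)%N ->
  g k - q * dl k = seq_slope k / c k.+1 * D k.
Proof.
move=> kN; rewrite /delta_of gamma_ofE /seq_slope /coef_d.
by field; rewrite gt_eqF// seq_c_gt0.
Qed.

Lemma next_sq_gt0 k : (k < N)%N -> 0 < D k -> 0 < next_sq q N r eta k (D k).
Proof.
move=> kN Dk; rewrite /next_sq slope_ofE// gap_ofE//.
have c1 : 0 < c k.+1 by rewrite seq_c_gt0.
have cb : 0 < c k.+1 - b k.+1 by rewrite subr_gt0 seq_b_lt_seq_c.
have sl := seq_slope_gt0 kN.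
case: eqP => [E|/eqP kN'].
  by rewrite divr_gt0 ?mulr_gt0 ?invr_gt0// (seq_a_gt0 hr) ?hN/=.
have kN2 : (k.+2 <= N)%N by rewrite ltn_neqAle kN' kN.
have c2 : 0 < c k.+2 by rewrite seq_c_gt0.
have b2 : 0 < b k.+2 by rewrite (seq_b_gt0 q0 q1 hr).
by rewrite !mulr_gt0 ?invr_gt0.
Qed.

Lemma candidate_D_gt0 k : (k <= N)%N -> 0 < D k.
Proof.
elim: k => [//|k IH] kN /=.
by rewrite sqrtr_gt0 next_sq_gt0// IH// ltnW.
Qed.

Lemma candidate_D_sq k : (k < N)%N ->
  D k.+1 ^+ 2 = next_sq q N r eta k (D k).
Proof.
by move=> kN /=; rewrite sqr_sqrtr// ltW// next_sq_gt0// candidate_D_gt0// ltnW.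
Qed.

Lemma candidate_chain_wd : candidate_chain_well_defined q N wx wf eta D0.
Proof.
split=> [k kN|k kN||k kN].
- by rewrite gt_eqF// seq_c_gt0.
- by rewrite gt_eqF// (seq_b_gt0 q0 q1 hr)//= -ltn_predRL.
- by rewrite gt_eqF// (seq_a_gt0 hr)// hN leqnn.
- by rewrite ltW// next_sq_gt0// candidate_D_gt0// ltnW.
Qed.

Local Notation C := (candidate_chain q N wx wf eta D0).

Lemma chain_gammaE k : (k < N)%N -> chain_gamma C k = g k.
Proof. by move=> kN; rewrite /= ltn_eqF. Qed.

Lemma chain_gamma_last : chain_gamma C N = a N * D N.
Proof. by rewrite /= eqxx. Qed.

(** The ratio [gamma_(k+1) / D_(k+1)] is [b / c] before [N] and [a_N] at [N]; in both cases it
    cancels the prefactor in [next_sq]. *)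
Lemma chain_step k : (k < N)%N ->
  chain_gamma C k.+1 * D k.+1 = (g k - q * dl k) * (D k - g k).
Proof.
move=> kN; have := candidate_D_sq kN; rewrite /next_sq.
case: (eqVneq k.+1 N) => [E|kN'] DD.
  have -> : chain_gamma C k.+1 = a N * D k.+1.
    by rewrite E; exact: chain_gamma_last.
  rewrite -mulrA -expr2 DD mulrCA mulfV ?mulr1//.
  by rewrite gt_eqF// (seq_a_gt0 hr)// hN leqnn.
have kN2 : (k.+1 < N)%N by rewrite ltn_neqAle kN' kN.
rewrite chain_gammaE// gamma_ofE -mulrA -expr2 DD.
have c2 : 0 < c k.+2 by rewrite seq_c_gt0.
have b2 : 0 < b k.+2 by rewrite (seq_b_gt0 q0 q1 hr).
by field; rewrite !gt_eqF.
Qed.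

(** For [k >= 1] this solves the linear recurrence of [hc_mult] divided by [D_k]: [q / r^2 * a k] is
    a particular solution and [b k] solves the homogeneous equation. The coefficient of [b k] is
    fixed by the value of [m_1] that [m_0 = 1] forces. *)
Definition chain_mult k : R :=
  if k == 0%N then 1 else
  q / r ^+ 2 * a k +
  (((1 - q) * b 1%N - q * s) / seq_slope 0 - q / r ^+ 2 * a 1%N) / b 1%N * b k.

(** Cleared of denominators, the claim reads [q s (r^2 - q a_1^2) <= (1 - q) (r^2 - q a_1) b_1]. As
    [r^2 - q a_1^2 = b_1^2], this is [boundary_ineq] times [b_1]. *)
Let slope_coef_ge0 :
  0 <= (((1 - q) * b 1%N - q * s) / seq_slope 0 - q / r ^+ 2 * a 1%N) / b 1%N.
Proof.
have b1 := seq_b_gt0 q0 q1 hr h1; have sl0 := seq_slope_gt0 hN.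
have r0 : 0 < r ^+ 2 by rewrite exprn_gt0// induced_radius_gt0.
rewrite divr_ge0 ?(ltW b1)// subr_ge0 ler_pdivlMr//.
rewrite (mulrAC q) (mulrAC (q * _)) ler_pdivrMr//.
have := ler_wpM2r (ltW b1) boundary_ineq.
have := seq_ab_norm q0 q1 hr h1; rewrite seq_slope0; move: (r ^+ 2) => r2 Er H.
have {}H : (q * s) * (r2 - q * a 1%N ^+ 2) <=
           (1 - q) * (r2 - q * a 1%N) * b 1%N.
  by rewrite -[r2 in X in X <= _]Er addrAC subrr add0r expr2 mulrA.
lra.
Qed.

Lemma chain_mult_eq k : (k < N)%N ->
  chain_mult k.+1 * seq_slope k = chain_mult k * b k.+1 - q * c k.+1.
Proof.
have b1 := seq_b_gt0 q0 q1 hr h1; have sl0 := seq_slope_gt0 hN.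
have r0 : r != 0 by rewrite gt_eqF// induced_radius_gt0.
case: k => [_|k kN]; rewrite /chain_mult /=.
  rewrite seq_c1; set t := q / _; set u := _ / seq_slope 0.
  have -> : t * a 1%N + (u - t * a 1%N) / b 1%N * b 1%N = u.
    by field; rewrite gt_eqF.
  by rewrite /u; field; rewrite gt_eqF.
rewrite seq_slopeS// seq_cS.
set K := _ / b 1%N; have [Ea Eb] := seq_ab_step (q := q) (r := r) kN.
have nrm := seq_ab_norm q0 q1 hr (kN : (1 <= k.+2 <= N)%N).
(* The discrete Wronskian of the rotation: it expresses [c_(k+2)] through [a] and [b], after which
   the recurrence is a field identity. *)
have W : a k.+1 * b k.+2 - a k.+2 * b k.+1 = coef_c q (a k.+2) * r ^+ 2.
  by rewrite Ea Eb -nrm; ring.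
have {W} -> : coef_c q (a k.+2) = (a k.+1 * b k.+2 - a k.+2 * b k.+1) / r ^+ 2.
  by rewrite W mulfK// expf_neq0.
by field.
Qed.

Lemma candidate_hard_chain :
  hard_chain q N (chain_D C) (chain_gamma C) (chain_delta C) chain_mult.
Proof.
have Dk k : (k <= N)%N -> 0 < D k := @candidate_D_gt0 k.
have c0 k : (k < N)%N -> 0 < c k.+1 by move=> kN; rewrite seq_c_gt0.
have b0 k : (k < N)%N -> 0 < b k.+1 by move=> kN; rewrite (seq_b_gt0 q0 q1 hr).
have aN0 : 0 < a N by rewrite (seq_a_gt0 hr)// hN leqnn.
have aN1 : a N < 1 by rewrite (seq_a_lt1 hr)// hN leqnn.
have Dk' k (kN : (k < N)%N) := Dk _ (ltnW kN).
have g0 k : (k < N)%N -> 0 < g k.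
  by move=> kN; rewrite gamma_ofE !mulr_gt0 ?invr_gt0 ?c0 ?b0 ?Dk'.
have gap k : (k < N)%N -> 0 < D k - g k.
  move=> kN; rewrite gap_ofE// !mulr_gt0 ?invr_gt0 ?c0 ?Dk'//.
  by rewrite subr_gt0 seq_b_lt_seq_c.
have slope k : (k < N)%N -> 0 < g k - q * dl k.
  by move=> kN; rewrite slope_ofE// !mulr_gt0 ?invr_gt0 ?c0 ?Dk' ?seq_slope_gt0.
have mult k : (k < N)%N ->
    chain_mult k.+1 * (g k - q * dl k) = chain_mult k * g k - q * D k.
  move=> kN; rewrite slope_ofE// mulrA mulrA chain_mult_eq// gamma_ofE.
  by field; rewrite gt_eqF// c0.
(* After multiplication by the positive slope the claim is [m_k delta_k <= D_k], true because
   [m_k <= 1] and [0 <= delta_k <= D_k]. The bound [m_k <= 1] follows in turn from the earlier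
   decreases, by the induction in [le1]. *)
have dec k : (k < N)%N -> chain_mult k <= 1 -> chain_mult k.+1 <= chain_mult k.
  move=> kN m1; rewrite -(ler_pM2r (slope k kN)) mult// mulrBr lerD2l lerN2.
  rewrite mulrCA ler_wpM2l//.
  have a0 := seq_a_gt0 hr (kN : (1 <= k.+1 <= N)%N).
  have a1 := seq_a_lt1 hr (kN : (1 <= k.+1 <= N)%N).
  have dl0 : 0 <= dl k.
    by rewrite /delta_of addr_ge0// mulr_ge0 ?subr_ge0 ?ltW ?Dk' ?g0.
  apply: (@le_trans _ _ (dl k)); first by exact: ler_piMl.
  have : 0 <= (1 - a k.+1) * (D k - g k).
    by rewrite mulr_ge0 ?(ltW (gap k kN))// subr_ge0 ltW.
  rewrite /delta_of; lra.
have le1 k : (k <= N)%N -> chain_mult k <= 1.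
  elim: k => [//|k IH] kN.
  by apply: le_trans (dec k kN _) _; apply: IH; exact: ltnW.
have mN : chain_mult N = q / r ^+ 2 * a N +
    (((1 - q) * b 1%N - q * s) / seq_slope 0 - q / r ^+ 2 * a 1%N) / b 1%N * b N.
  by rewrite /chain_mult gtn_eqF.
have bN : 0 < b N by rewrite (seq_b_gt0 q0 q1 hr)// hN leqnn.
split=> /=.
- exact: Dk.
- move=> k kN; have [_|kN'] := eqVneq k N; first by rewrite mulr_gt0 ?Dk.
  by apply: g0; rewrite ltn_neqAle kN' kN.
- move=> k kN; have [->|kN'] := eqVneq k N; first by rewrite ger_pMl ?Dk// ltW.
  by rewrite -subr_ge0 ltW// gap// ltn_neqAle kN' kN.
- by move=> k kN; rewrite ltn_eqF// slope.
- by move=> k kN; have := chain_step kN; rewrite /= [k == N]ltn_eqF.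
- by [].
- by move=> k kN; rewrite ltn_eqF// mult.
- by move=> k kN; apply: dec => //; apply: le1; exact: ltnW.
- rewrite mN addr_ge0//; last by rewrite mulr_ge0 ?slope_coef_ge0// ltW.
  by rewrite !mulr_ge0 ?invr_ge0 ?sqr_ge0// ltW.
(* Here [gamma_N = a_N D_N] and [a_N = r], so the [a] part of [m_N] times [a_N] is exactly [q]; the
   [b] part is nonnegative. *)
- rewrite eqxx mulrA ler_pM2r ?Dk// mN mulrDl.
  rewrite seq_a_last -[in X in X + _]mulrA -expr2 divfK; last first.
    by rewrite expf_neq0// gt_eqF// induced_radius_gt0.
  rewrite lerDl mulr_ge0 ?(ltW induced_radius_gt0)//.
  by rewrite mulr_ge0 ?slope_coef_ge0// ltW.
Qed.

(** * The telescoping identity for [Phi] *)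

Let energy k := 2 * (1 - a k.+1) * ((g k - q * dl k) * (D k - g k)).

Let energy0 : energy 0 =
  q * (1 - a 1%N) ^+ 2 * (D0 - g 0) ^+ 2
  + (1 - q) * (eta * (wx + wf) * D0 ^+ 2 + eta * (1 - wx - wf) * g 0 ^+ 2
               + 2 * residual q N wx wf eta * g 0 * (D0 - g 0))
  - eta * wf * (D0 - g 0) ^+ 2.
Proof.
have c1 : c 1%N != 0 by rewrite gt_eqF// seq_c_gt0.
rewrite /energy slope_ofE// gap_ofE// gamma_ofE /= seq_slope0.
(* In the unit [t] the boundary values are [D_0 = c_1 t], [gamma_0 = b_1 t] and
   [D_0 - gamma_0 = s t], which makes the identity polynomial. *)
set t := D0 / c 1%N.
have x1 : D0 = c 1%N * t by rewrite mulrC divfK.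
have -> : b 1%N / c 1%N * D0 = b 1%N * t by rewrite mulrAC mulrA.
have -> : (c 1%N - b 1%N) / c 1%N * D0 = s * t.
  by rewrite seq_c1 addrAC subrr add0r mulrAC mulrA.
have -> : ((1 - q) * b 1%N - q * a 1%N * s) / c 1%N * D0 =
          ((1 - q) * b 1%N - q * a 1%N * s) * t by rewrite mulrAC mulrA.
rewrite x1 seq_c1.
have nrm := seq_ab_norm q0 q1 hr h1; rewrite induced_radius_sq in nrm.
have res := residualE; move: (residual _ _ _ _ _) res => H res.
move: s (sqr_s) res => s' s2 res.
(* Replacing [b_1^2] by [r^2 - q a_1^2] and [r^2] by its definition cancels every term in [eta]. *)
have key : q * (1 - a 1%N) ^+ 2 + (wx + wf) * s' ^+ 2 - b 1%N ^+ 2 - eta * wf =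
    - (2 * (1 - a 1%N) * q * a 1%N).
  by rewrite s2; lra.
transitivity (t ^+ 2 * (q * (1 - a 1%N) ^+ 2 * s' ^+ 2
  + ((1 - q) * eta) * ((wx + wf) * (b 1%N + s') ^+ 2 + (1 - wx - wf) * b 1%N ^+ 2)
  + 2 * ((1 - q) * H) * b 1%N * s' - eta * wf * s' ^+ 2)); last ring.
rewrite -s2 res.
transitivity (t ^+ 2 * (2 * (1 - q) * (1 - a 1%N) * b 1%N * s'
  + s' ^+ 2 * (q * (1 - a 1%N) ^+ 2 + (wx + wf) * s' ^+ 2 - b 1%N ^+ 2 - eta * wf)));
  last ring.
by rewrite key; ring.
Qed.

(** The step relation turns [energy k] into [2 (1 - a_(k+1)) gamma_(k+1) D_(k+1)], so both energies
    are multiples of [D_(k+1)^2]. The difference of the two sides is then a multiple of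
    [c^2 - radicand], which is zero. *)
Let energyS k : (k.+1 < N)%N ->
  energy k.+1 = energy k + (r ^+ 2 - q) * D k.+1 ^+ 2
    + q * (1 - a k.+2) ^+ 2 * (D k.+1 - g k.+1) ^+ 2.
Proof.
move=> kN; have := chain_step (ltnW kN); rewrite chain_gammaE// => Ek.
rewrite /energy -Ek slope_ofE// gap_ofE// gamma_ofE seq_slopeS//.
have [Ea Eb] := seq_ab_step (q := q) (r := r) kN.
have nrm := seq_ab_norm q0 q1 hr (kN : (1 <= k.+2 <= N)%N).
have cc := coef_c_sq q0 q1 hr (kN : (1 <= k.+2 <= N)%N).
have c0 := coef_c_gt0 q0 q1 hr (kN : (1 <= k.+2 <= N)%N).
rewrite seq_cS; move: (D k.+1) => Dk.
set t := Dk / coef_c q (a k.+2).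
have -> : b k.+2 / coef_c q (a k.+2) * Dk = b k.+2 * t by rewrite mulrAC mulrA.
have -> : (coef_c q (a k.+2) - b k.+2) / coef_c q (a k.+2) * Dk =
  (coef_c q (a k.+2) - b k.+2) * t by rewrite mulrAC mulrA.
have -> : b k.+1 / coef_c q (a k.+2) * Dk = b k.+1 * t by rewrite mulrAC mulrA.
have -> : Dk = coef_c q (a k.+2) * t by rewrite mulrC divfK// gt_eqF.
apply/eqP; rewrite -subr_eq0; apply/eqP.
move: (a k.+2) (b k.+2) (a k.+1) (b k.+1) Ea Eb nrm cc t {c0} => a' b' a1 b1.
move: (coef_c q a') => c' -> -> <- cc t.
transitivity (t ^+ 2 * b' ^+ 2 * (c' ^+ 2 - radicand q a')); last first.
  by rewrite cc subrr mulr0.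
by rewrite /coef_d /radicand; ring.
Qed.

Let sumr_recr m n (F : nat -> R) : (m <= n)%N ->
  \sum_(m <= l < n.+1) F l = \sum_(m <= l < n) F l + F n.
Proof. by move=> mn; rewrite big_nat_recr. Qed.

Let energy_sum n : (n < N)%N ->
  energy n = energy 0 - q * (1 - a 1%N) ^+ 2 * (D0 - g 0) ^+ 2
    + (r ^+ 2 - q) * \sum_(1 <= l < n.+1) D l ^+ 2
    + q * \sum_(0 <= l < n.+1) (D l - dl l) ^+ 2.
Proof.
have gapE l : (D l - dl l) ^+ 2 = (1 - a l.+1) ^+ 2 * (D l - g l) ^+ 2.
  by rewrite /delta_of; ring.
elim: n => [_|n IH nN].
  by rewrite big_geq// big_nat1 gapE /=; ring.
rewrite energyS// IH ?(ltnW nN)// !(sumr_recr (n := n.+1))//.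
by rewrite gapE; ring.
Qed.

(** At [k = N - 1] the energy is [2 (1 - r) r D_N^2], so [(1 - q) Phi] is that energy plus
    [(r^2 - q) D_N^2] minus [q] times the sum of [(D_l - delta_l)^2]. This sum cancels the one in
    [energy_sum], and [r^2 - q = eta ((1 - q) wx - q wf)] distributes the weights. *)
Lemma certificate_identity : wx + wf + wg = 1 ->
  cert_Phi q N C =
    eta * (wx * init_Bx N C + wf * init_Bf q N C + wg * init_Bg C)
    + 2 * residual q N wx wf eta * chain_gamma C 0
        * (chain_D C 0 - chain_gamma C 0).
Proof.
move=> hw; have -> : wg = 1 - wx - wf by rewrite -hw; ring.
have N1 : (N.-1 < N)%N by rewrite prednK.
have := energy_sum N1; have := chain_step N1.
rewrite energy0 /energy prednK// => <-.
rewrite chain_gamma_last seq_a_last => E.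
rewrite /cert_Phi /init_Bx /init_Bf /init_Bg (chain_gammaE hN) chain_gamma_last.
rewrite seq_a_last !(sumr_recr (n := N))//= [\sum_(0 <= l < N) D l ^+ 2]big_ltn//=.
apply: (mulfI (lt0r_neq0 q'0)).
move: E; rewrite /=.
move: (\sum_(0 <= l < N) _) (\sum_(1 <= l < N) _) => S2 S1.
move: (gamma_of _ _ _ _ _ _) (residual _ _ _ _ _) (D N) => g0 H X E.
have fl x y : (1 - q) * (x - y / (1 - q)) = (1 - q) * x - y.
  by rewrite mulrBr mulrCA mulfV ?mulr1// lt0r_neq0.
rewrite fl; transitivity ((1 - q) * (eta * (wx * (D0 ^+ 2 + S1 + X ^+ 2)
    + (1 - wx - wf) * g0 ^+ 2) + 2 * H * g0 * (D0 - g0)) + eta * wf *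
  ((1 - q) * (D0 ^+ 2 - ((D0 - g0) ^+ 2 + q * (S1 + X ^+ 2)) / (1 - q))));
  last ring.
rewrite fl; have e1 := congr1 ( *%R^~ S1) induced_radius_sq.
have e2 := congr1 ( *%R^~ (X ^+ 2)) induced_radius_sq.
by move: e1 e2 E => /=; move: r => r' e1 e2 E; lra.
Qed.

End Chain.
End CandidateChainTheory.

(** * Inequalities for the slopes of a hard chain, in coordinates *)

Section HardChainTheory.
Context {R : realType} {q : R} {N : nat} {D g dl m : nat -> R}.
Hypothesis hc : hard_chain q N D g dl m.
Implicit Types (z : nat -> R).

(** The inner product of a vector with [s_k + q y_0], where [z l] is its inner product with
    [e_l]. *)
Definition slope_form z k : R :=
  g k * z k + q * \sum_(0 <= l < k) dl l * z l.

Lemma slope_formS z k :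
  slope_form z k.+1 = slope_form z k + g k.+1 * z k.+1 - (g k - q * dl k) * z k.
Proof. by rewrite /slope_form big_nat_recr//=; ring. Qed.

(** By the step relation the increment from [j] to [j + 1] is [(g_j - q dl_j) ((D_j - g_j) - z_j)].
    It is nonpositive at [j = k] by hypothesis and later because [z_j = D_j]. *)
Lemma slope_form_dec z k : (k < N)%N ->
  (forall l, (k < l <= N)%N -> z l = D l) -> D k - g k <= z k ->
  forall j, (k <= j <= N)%N -> slope_form z j <= slope_form z k.
Proof.
move=> kN zD zk; elim=> [|j IH] /andP[kj jN].
  by move: kj; rewrite leqn0 => /eqP ->.
move: kj; rewrite leq_eqVlt => /predU1P[<- //|kj].
apply: le_trans (IH _); last by rewrite -ltnS kj (ltnW jN).
rewrite slope_formS zD ?leqnn ?kj ?jN// (hc_step hc)//.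
rewrite -addrA gerDl subr_le0 ler_pM2l ?(hc_slope hc)//.
move: kj; rewrite ltnS leq_eqVlt => /predU1P[<- //|kj].
by rewrite zD ?kj ?(ltnW jN)// gerBl ltW// (hc_g_gt0 hc)// (ltnW jN).
Qed.

(** Summation by parts: [hc_mult] is the condition that the coefficient of each [z l] comes out as
    [q D_l]. *)
Lemma mult_sum z n : (n <= N)%N ->
  \sum_(0 <= i < n) (m i - m i.+1) * slope_form z i
    + m n * (q * \sum_(0 <= l < n) dl l * z l)
  = q * \sum_(0 <= l < n) D l * z l.
Proof.
elim: n => [|n IH] nN; first by rewrite !big_geq//; ring.
rewrite !big_nat_recr//= [in RHS]mulrDr -IH ?(ltnW nN)//.
have E := hc_mult hc nN.
rewrite /slope_form; set S := \sum_(0 <= l < n) dl l * z l.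
have -> : q * (D n * z n) = (m n * g n - m n.+1 * (g n - q * dl n)) * z n.
  by rewrite E; ring.
ring.
Qed.

(** The weights [m_i - m_(i+1)] and [m_N] are nonnegative with sum [m_0 = 1]. The corresponding
    average of the forms is at least [q sum D_l z_l], by [mult_sum] and, for the coordinate [N],
    [hc_mult_last]. *)
Lemma slope_form_bound z M :
  (forall i, (i <= N)%N -> slope_form z i <= M) -> 0 <= z N ->
  q * \sum_(0 <= l < N.+1) D l * z l <= M.
Proof.
move=> zM zN; have E := mult_sum z (leqnn N).
rewrite big_nat_recr//= mulrDr -E -addrA.
have -> : M = \sum_(0 <= i < N) (m i - m i.+1) * M + m N * M.
  rewrite -mulr_suml -mulrDl (@telescope_sumr_eq _ _ _ (fun i => - m i))//; last first.
    by move=> i _; rewrite opprK addrC.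
  by rewrite (hc_mult0 hc); ring.
apply: lerD.
  rewrite big_nat_cond [in leRHS]big_nat_cond; apply: ler_sum => i.
  move=> /andP[/andP[_ iN] _]; rewrite ler_wpM2l ?zM ?(ltnW iN)//.
  by rewrite subr_ge0 (hc_mult_dec hc).
apply: (@le_trans _ _ (m N * slope_form z N)); last first.
  by rewrite ler_wpM2l ?zM// (hc_mult_ge0 hc).
rewrite /slope_form mulrDr addrC lerD2r mulrA mulrA.
by rewrite ler_wpM2r// (hc_mult_last hc).
Qed.

End HardChainTheory.

(** * Homogeneity of the candidate chain in [D_0] *)

Section CandidateScaling.
Context {R : realType} (q wx wf eta : R) (N : nat) (t : R).
Hypothesis t0 : 0 < t.
Local Notation r := (induced_radius q wx wf eta).
Local Notation C := (candidate_chain q N wx wf eta).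

Lemma candidate_D_scale D0 k :
  candidate_D q N r eta (t * D0) k = t * candidate_D q N r eta D0 k.
Proof.
elim: k => [//|k IH] /=; rewrite IH; set x := candidate_D _ _ _ _ _ _.
have -> : next_sq q N r eta k (t * x) = t ^+ 2 * next_sq q N r eta k x.
  by rewrite /next_sq /delta_of /gamma_of; case: ifP => _; ring.
by rewrite sqrtrM ?sqr_ge0// sqrtr_sqr gtr0_norm.
Qed.

Lemma init_Bx_scale D0 : init_Bx N (C (t * D0)) = t ^+ 2 * init_Bx N (C D0).
Proof.
rewrite /init_Bx mulr_sumr; apply: eq_bigr => l _ /=.
by rewrite candidate_D_scale exprMn.
Qed.

Lemma init_Bg_scale D0 : (0 < N)%N ->
  init_Bg (C (t * D0)) = t ^+ 2 * init_Bg (C D0).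
Proof.
by move=> N0; rewrite /init_Bg /= ltn_eqF// /gamma_of; ring.
Qed.

Lemma init_Bf_scale D0 : (0 < N)%N ->
  init_Bf q N (C (t * D0)) = t ^+ 2 * init_Bf q N (C D0).
Proof.
move=> N0; rewrite /init_Bf /= ltn_eqF// /gamma_of.
rewrite (eq_bigr (fun l => t ^+ 2 * candidate_D q N r eta D0 l ^+ 2)); last first.
  by move=> l _; rewrite candidate_D_scale exprMn.
by rewrite -mulr_sumr; ring.
Qed.

End CandidateScaling.

(** Apply [slope_form_bound] to [z = (D_0 - g_0, D_1, ..., D_N)], whose largest form is
    [g_0 (D_0 - g_0)]. This bounds [q sum_(l >= 1) D_l^2] and gives [B_f >= D_0 g_0]. *)
Lemma init_Bf_gt0 (R : realType) (q : R) N (C : chain R) m :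
  q < 1 -> (0 < N)%N ->
  hard_chain q N (chain_D C) (chain_gamma C) (chain_delta C) m ->
  0 < init_Bf q N C.
Proof.
move=> q1 N0 hc; rewrite /init_Bf.
move: hc; move: (chain_D C) (chain_gamma C) (chain_delta C) => D g dl hc.
pose z l := if l == 0%N then D 0%N - g 0%N else D l.
have zS l : (0 < l)%N -> z l = D l by case: l.
have dec : forall j, (0 <= j <= N)%N ->
    slope_form (q := q) (g := g) (dl := dl) z j <=
    slope_form (q := q) (g := g) (dl := dl) z 0.
  by apply: (slope_form_dec hc) => // l /andP[l0 _]; rewrite zS.
have := slope_form_bound hc (fun i iN => dec i iN).
rewrite zS// => /(_ (ltW (hc_D_gt0 hc (leqnn N)))).
have -> : slope_form (q := q) (g := g) (dl := dl) z 0 = g 0%N * z 0%N.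
  by rewrite /slope_form [X in q * X]big_geq// mulr0 addr0.
have -> : z 0%N = D 0%N - g 0%N by [].
rewrite big_ltn//=; have -> : z 0%N = D 0%N - g 0%N by [].
have -> : \sum_(1 <= l < N.+1) D l * z l = \sum_(1 <= l < N.+1) D l ^+ 2.
  by apply: eq_big_nat => i /andP[i0 _]; rewrite zS// expr2.
move: (\sum_(1 <= l < N.+1) _) => S H.
have DG : 0 < D 0%N * g 0%N * (1 - q).
  by rewrite !mulr_gt0 ?subr_gt0// ?(hc_D_gt0 hc)// (hc_g_gt0 hc).
have q'0 : 0 < 1 - q by rewrite subr_gt0.
by rewrite subr_gt0 ltr_pdivrMr//; lra.
Qed.

(** * Euclidean geometry of row vectors *)

Section EuclideanProduct.
Context {R : realType} {d : nat}.
Local Notation V := 'rV[R]_d.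
Implicit Types x y z : V.

Definition dot x y : R := \sum_(i < d) x 0 i * y 0 i.

Lemma dotC x y : dot x y = dot y x.
Proof. by apply: eq_bigr => i _; rewrite mulrC. Qed.

Lemma dotDl x y z : dot (x + y) z = dot x z + dot y z.
Proof. by rewrite -big_split; apply: eq_bigr => i _; rewrite mxE mulrDl. Qed.

Lemma dotZl (k : R) x y : dot (k *: x) y = k * dot x y.
Proof. by rewrite mulr_sumr; apply: eq_bigr => i _; rewrite mxE mulrA. Qed.

Lemma dotNl x y : dot (- x) y = - dot x y.
Proof. by rewrite -scaleN1r dotZl mulN1r. Qed.

Lemma dotBl x y z : dot (x - y) z = dot x z - dot y z.
Proof. by rewrite dotDl dotNl. Qed.

Lemma dot0l x : dot 0 x = 0.
Proof. by rewrite -[0](scale0r 0) dotZl mul0r. Qed.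

Lemma dotDr x y z : dot x (y + z) = dot x y + dot x z.
Proof. by rewrite !(dotC x) dotDl. Qed.

Lemma dotZr (k : R) x y : dot x (k *: y) = k * dot x y.
Proof. by rewrite !(dotC x) dotZl. Qed.

Lemma dotNr x y : dot x (- y) = - dot x y.
Proof. by rewrite !(dotC x) dotNl. Qed.

Lemma dotBr x y z : dot x (y - z) = dot x y - dot x z.
Proof. by rewrite !(dotC x) dotBl. Qed.

Lemma dot0r x : dot x 0 = 0.
Proof. by rewrite dotC dot0l. Qed.

Definition dotE := (dotDl, dotDr, dotBl, dotBr, dotZl, dotZr, dotNl, dotNr).

Lemma dot_suml (I : Type) (s : seq I) (P : pred I) (F : I -> V) y :
  dot (\sum_(i <- s | P i) F i) y = \sum_(i <- s | P i) dot (F i) y.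
Proof. exact: (big_morph (dot^~ y) (fun a b => dotDl a b y) (dot0l y)). Qed.

Lemma dot_sumr (I : Type) (s : seq I) (P : pred I) (F : I -> V) y :
  dot y (\sum_(i <- s | P i) F i) = \sum_(i <- s | P i) dot y (F i).
Proof. by rewrite dotC dot_suml; apply: eq_bigr => i _; rewrite dotC. Qed.

Lemma dot_ge0 x : 0 <= dot x x.
Proof. by apply: sumr_ge0 => i _; rewrite -expr2 sqr_ge0. Qed.

Lemma dot_eq0 x : dot x x = 0 -> x = 0.
Proof.
move=> /eqP; rewrite psumr_eq0; last by move=> i _; rewrite -expr2 sqr_ge0.
move=> /allP x0; apply/rowP => i; rewrite mxE.
by have := x0 i (mem_index_enum i); rewrite /= -expr2 sqrf_eq0 => /eqP.
Qed.

Lemma l2norm_sq x : l2norm x ^+ 2 = dot x x.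
Proof. by rewrite sqr_sqrtr ?dot_ge0// sumr_ge0// => i _; rewrite sqr_ge0. Qed.

Lemma l2norm_ge0 x : 0 <= l2norm x.
Proof. exact: sqrtr_ge0. Qed.

Lemma dot_le_l2norm x y : dot x y <= l2norm x * l2norm y.
Proof.
have [y0|y0] := eqVneq (l2norm y) 0.
  have -> : y = 0 by apply: dot_eq0; rewrite -l2norm_sq y0 expr0n.
  by rewrite dot0r mulr_ge0 ?l2norm_ge0.
have yp : 0 < l2norm y by rewrite lt0r y0 l2norm_ge0.
have := dot_ge0 (l2norm y *: x - l2norm x *: y).
rewrite !dotE -!l2norm_sq (dotC y x) => H.
have [x0|x0] := eqVneq (l2norm x) 0.
  have -> : x = 0 by apply: dot_eq0; rewrite -l2norm_sq x0 expr0n.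
  by rewrite dot0l mulr_ge0 ?l2norm_ge0.
have xp : 0 < l2norm x by rewrite lt0r x0 l2norm_ge0.
have xyp : 0 < l2norm x * l2norm y by rewrite mulr_gt0.
rewrite -(ler_pM2l xyp); nra.
Qed.

Lemma l2norm_triangle x y : l2norm (x + y) <= l2norm x + l2norm y.
Proof.
rewrite -ler_sqr ?nnegrE ?addr_ge0 ?l2norm_ge0//.
rewrite l2norm_sq !dotE (dotC y x) sqrrD !l2norm_sq.
have := dot_le_l2norm x y; lra.
Qed.

Lemma l2normZ (k : R) x : 0 <= k -> l2norm (k *: x) = k * l2norm x.
Proof.
move=> k0; apply/eqP; rewrite -(@eqrXn2 _ 2) ?mulr_ge0 ?l2norm_ge0//.
by rewrite exprMn !l2norm_sq !dotE mulrA expr2.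
Qed.

(** Differentiability is stated with the sup norm; this carries Euclidean quadratic bounds over to
    it. *)
Lemma dot_le_norm x : dot x x <= d%:R * `|x| ^+ 2.
Proof.
have -> : d%:R * `|x| ^+ 2 = \sum_(i < d) `|x| ^+ 2.
  by rewrite sumr_const card_ord mulr_natl.
apply: ler_sum => i _; rewrite -expr2 -real_normK ?num_real// ler_sqr ?nnegrE//.
by rewrite [`|x|]mx_normrE (le_bigmax _ (fun ij => `|x ij.1 ij.2|) (0, i)).
Qed.

End EuclideanProduct.

(** * Gradients from quadratic remainder bounds *)

HB.instance Definition _ (R : realType) (d : nat) (u : 'rV[R]_d) :=
  GRing.isLinear.Build R 'rV[R]_d R *%R (dot u)
    (fun k x y => etrans (dotDr u (k *: x) y) (congr1 (+%R^~ _) (dotZr k u x))).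

Lemma continuous_sumr (R : realType) (T : topologicalType) (I : Type)
    (s : seq I) (F : I -> T -> R) :
  (forall i, continuous (F i)) -> continuous (fun x => \sum_(i <- s) F i x).
Proof.
move=> cF; elim: s => [|i s IH].
  by rewrite (_ : (fun _ => _) = cst 0) ?funeqE//; [exact: cst_continuous |
    move=> x; rewrite big_nil].
rewrite (_ : (fun _ => _) = F i \+ (fun x => \sum_(i <- s) F i x)).
  by move=> x; apply: continuousD; [exact: cF | exact: IH].
by rewrite funeqE => x; rewrite big_cons.
Qed.

Lemma quadratic_diff (K : realFieldType) (V W : normedModType K) (f : V -> W)
    (df : {linear V -> W}) (x : V) (M : K) :
  continuous df -> 0 <= M ->
  (forall v, `|f (x + v) - f x - df v| <= M * `|v| ^+ 2) ->
  differentiable f x /\ 'd f x = df :> (V -> W).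
Proof.
move=> cdf M0 H.
have M1 : 0 < M + 1 by rewrite ltr_wpDl.
have expansion : f \o shift x = cst (f x) + df +o_ 0 id.
  apply/eqaddoP => _/posnumP[e]; near=> v.
  have -> : (f \o shift x - (cst (f x) + df)) v = f (x + v) - f x - df v.
    by rewrite -[LHS]/(f (v + x) - (f x + df v)) opprD addrA (addrC v).
  apply: le_trans (H v) _; rewrite expr2 mulrA ler_wpM2r//.
  (* With [M + 1] in place of [M], the radius [e / (M + 1)] makes sense even for [M = 0]. *)
  apply: (@le_trans _ _ ((M + 1) * `|v|)); first by rewrite ler_wpM2r// lerDl.
  rewrite -ler_pdivlMl//; near: v.
  apply/nbhs_norm0P; exists ((M + 1)^-1 * e%:num) => /=.
    by rewrite mulr_gt0 ?invr_gt0.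
  by move=> v /= /ltW.
have dE := diff_unique cdf expansion.
by split=> //; apply/diff_locallyP; rewrite dE.
Unshelve. all: by end_near. Qed.

Section QuadraticExpansion.
Context {R : realType} {d : nat}.
Implicit Types x G v : 'rV[R]_d.

Lemma dot_continuous G : continuous (dot G : 'rV[R]_d -> R).
Proof.
apply: continuous_sumr => i x.
by apply: continuousM; [exact: cst_continuous | exact: coord_continuous].
Qed.

Lemma quadratic_gradient (f : 'rV[R]_d -> R) x G (M : R) : 0 <= M ->
  (forall v, `|f (x + v) - f x - dot G v| <= M * dot v v) ->
  differentiable f x /\ gradient f x = G.
Proof.
move=> M0 H.
have [df dE] : differentiable f x /\ 'd f x = dot G :> ('rV[R]_d -> R).
  apply: (quadratic_diff (M := M * d%:R)) => [||v].
  - exact: dot_continuous.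
  - by rewrite mulr_ge0.
  - by rewrite -mulrA (le_trans (H v))// ler_wpM2l// dot_le_norm.
split=> //; apply/rowP => i; rewrite mxE deriveE// dE.
rewrite /dot (bigD1 i)//= big1 ?addr0 ?mxE ?eqxx ?mulr1// => j ji.
by rewrite mxE eqxx (negbTE ji) mulr0.
Qed.

End QuadraticExpansion.

(** * Projection onto the convex hull of finitely many points *)

Section ConvexHullProjection.
Context {R : realType} {d : nat}.
Local Notation V := 'rV[R]_d.
Implicit Types (v : nat -> V) (w : nat -> R) (x y p : V).

Definition simplex n w : Prop :=
  (forall i, 0 <= w i) /\ \sum_(0 <= i < n) w i = 1.

Definition comb n w v : V := \sum_(0 <= i < n) w i *: v i.

(* Variational characterisation of the Euclidean projection [p] of [y] onto the
   convex hull of [v_0, ..., v_(n-1)]. *)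
Definition is_proj n v y p : Prop :=
  (exists2 w, simplex n w & p = comb n w v) /\
  forall j, (j < n)%N -> dot (y - p) (v j - p) <= 0.

Lemma dot_comb n w v x : dot x (comb n w v) = \sum_(0 <= i < n) w i * dot x (v i).
Proof. by rewrite dot_sumr; apply: eq_bigr => i _; rewrite dotZr. Qed.

Lemma is_proj_le n v y p w : is_proj n v y p -> simplex n w ->
  dot (y - p) (comb n w v - p) <= 0.
Proof.
move=> [_ H] [w0 w1]; rewrite dotBr dot_comb -[dot _ p]mul1r -w1 mulr_suml -sumrB.
rewrite big_nat; apply: sumr_le0 => i /andP[_ iN].
by rewrite -mulrBr -dotBr mulr_ge0_le0// H.
Qed.

Lemma simplex_compact n :
  compact [set a : 'rV[R]_n | (forall i, a ord0 i \in `[0, 1]) /\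
                              \sum_(i < n) a ord0 i = 1].
Proof.
have c01 : compact [set a : 'rV[R]_n | forall i, a ord0 i \in `[(0 : R), 1]].
  apply: (@rV_compact _ _ (fun=> `[(0 : R), 1]%classic)).
  by move=> _; apply: segment_compact.
apply: (compact_closedI c01).
apply: (@preimage_closed _ _ (fun a : 'rV[R]_n => \sum_(i < n) a ord0 i) [set 1]).
  by move=> a _; apply: continuous_sumr => i; exact: coord_continuous.
exact: closed_eq.
Qed.

(** Minimise the squared distance over the compact simplex of weights; moving the minimiser towards
    the vertex [v j] gives the variational inequality. *)
Lemma proj_exists n v y : (0 < n)%N -> exists p, is_proj n v y p.
Proof.
move=> n0.
pose cmb (a : 'rV[R]_n) := \sum_(i < n) a 0 i *: v i.
pose f a := dot (y - cmb a) (y - cmb a).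
have cf : continuous f.
  apply: continuous_sumr => j a.
  have cc : {for a, continuous (fun a => (y - cmb a) 0 j)}.
    have -> : (fun a => (y - cmb a) 0 j) =
              (fun a => y 0 j - \sum_(i < n) a 0 i * v i 0 j).
      rewrite funeqE => b; rewrite !mxE summxE; congr (_ - _).
      by apply: eq_bigr => i _; rewrite mxE.
    apply: continuousB; first exact: cst_continuous.
    apply: continuous_sumr => i b.
    by apply: continuousM; [exact: coord_continuous | exact: cst_continuous].
  exact: continuousM.
have [|c /set_mem [c01 c1] cmin] := compact_EVT_min _ (@simplex_compact n)
    (continuous_subspaceT cf).
  exists (delta_mx 0 (Ordinal n0)); split=> [i|].
    by rewrite mxE eqxx /= in_itv /=; case: eqP; rewrite ?lexx ler01.
  rewrite (bigD1 (Ordinal n0))//= big1 ?addr0 ?mxE ?eqxx// => i ji.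
  by rewrite mxE (negbTE ji) andbF.
have c0 i : 0 <= c 0 i by have := c01 i; rewrite /= in_itv => /andP[].
exists (cmb c); split.
  pose w i := if insub i is Some j then c 0 j else 0.
  have wE (i : 'I_n) : w i = c 0 i by rewrite /w valK.
  exists w; first split.
  - by rewrite /w => i; case: insub.
  - by rewrite big_mkord -[RHS]c1; apply: eq_bigr => i _; rewrite wE.
  - by rewrite /comb big_mkord; apply: eq_bigr => i _; rewrite wE.
move=> j jn; set p := cmb c; set u := v j - p.
pose e : 'rV[R]_n := delta_mx 0 (Ordinal jn).
have eE i : e 0 i = (i == Ordinal jn)%:R by rewrite mxE eqxx.
have line t : 0 <= t <= 1 ->
    dot (y - p) (y - p) <= dot (y - p - t *: u) (y - p - t *: u).
  move=> /andP[t0 t1].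
  have linE i : ((1 - t) *: c + t *: e) 0 i = (1 - t) * c 0 i + t * e 0 i.
    by rewrite !mxE.
  have := cmin ((1 - t) *: c + t *: e) (mem_set _).
  have cmbE : cmb ((1 - t) *: c + t *: e) = p + t *: u.
    rewrite /cmb (eq_bigr (fun i : 'I_n => (1 - t) *: (c 0 i *: v i) +
        t *: (e 0 i *: v i))); last first.
      by move=> i _; rewrite linE !scalerA -scalerDl.
    rewrite big_split/= -!scaler_sumr -/(cmb c) -/p.
    rewrite [\sum_(i < n) e 0 i *: v i](bigD1 (Ordinal jn))//= big1 ?addr0; last first.
      by move=> i ij; rewrite eE (negbTE ij) mulr0n scale0r.
    rewrite eE eqxx scale1r /u scalerBr scalerBl scale1r.
    by rewrite -addrA [- _ + _]addrC.
  rewrite /f cmbE opprD addrA; apply.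
  have nn i : 0 <= ((1 - t) *: c + t *: e) 0 i.
    by rewrite linE eE addr_ge0 ?mulr_ge0 ?subr_ge0.
  have s1 : \sum_(i < n) ((1 - t) *: c + t *: e) 0 i = 1.
    rewrite (eq_bigr (fun i : 'I_n => (1 - t) * c 0 i +
        t * e 0 i)); last by move=> i _; rewrite linE.
    rewrite big_split/= -!mulr_sumr c1 (bigD1 (Ordinal jn))//= big1 ?addr0; last first.
      by move=> i ij; rewrite eE (negbTE ij).
    by rewrite eE eqxx mulr1n; ring.
  split=> // i; rewrite /= in_itv /= nn /= -[leRHS]s1 (bigD1 i)//= lerDl.
  by apply: sumr_ge0 => k _; exact: nn.
rewrite leNgt; apply/negP => C0; set C := dot (y - p) u in C0.
have W0 := dot_ge0 u.
have CW : 0 < C + dot u u by rewrite ltr_pwDl.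
(* The denominator [C + |u|^2] keeps the step below [1]. Minimality would give [t |u|^2 >= 2 C],
   whereas [t |u|^2 = C - t C < C]. *)
have t0 : 0 < C / (C + dot u u) by rewrite divr_gt0.
have := line (C / (C + dot u u)).
rewrite (ltW t0) ler_pdivrMr// mul1r lerDl W0 => /(_ isT).
rewrite (dotBl (y - p)) !(dotBr _ (y - p)) !dotZl !dotZr (dotC u) -/C.
set t := C / _ => H; have tC : t * (C + dot u u) = C by rewrite divfK ?gt_eqF.
have : 0 <= t * (t * dot u u - 2 * C) by lra.
rewrite pmulr_rge0// => H2.
have : 0 < t * C by rewrite mulr_gt0.
lra.
Qed.

(** Add the two variational inequalities, each tested at the other projection. *)
Lemma proj_nonexpansive n v y y' p p' : is_proj n v y p -> is_proj n v y' p' ->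
  dot (p' - p) (p' - p) <= dot (y' - y) (p' - p).
Proof.
move=> hp hp'; have [[w sw pE] _] := hp; have [[w' sw' pE'] _] := hp'.
have := is_proj_le hp sw'; have := is_proj_le hp' sw; rewrite -pE -pE'.
rewrite !dotE !(dotC p) !(dotC p'); lra.
Qed.

Lemma proj_unique n v y p p' : is_proj n v y p -> is_proj n v y p' -> p = p'.
Proof.
move=> hp hp'; apply/eqP; rewrite eq_sym -subr_eq0; apply/eqP/dot_eq0/eqP.
rewrite eq_le dot_ge0 andbT (le_trans (proj_nonexpansive hp hp'))//.
by rewrite subrr dot0l.
Qed.

End ConvexHullProjection.

(** * Moreau envelopes of polyhedral support functions *)

Section Envelope.
Context {R : realType} {d : nat} {q : R} {n : nat} {v : nat -> 'rV[R]_d}.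
Hypotheses (q0 : 0 <= q) (q1 : q < 1) (n0 : (0 < n)%N).
Local Notation V := 'rV[R]_d.
Implicit Types (x y s u p : V).

Definition hull_proj y : V := xget 0 [set p | is_proj n v y p].

Lemma hull_projP y : is_proj n v y (hull_proj y).
Proof. exact: (xgetPex 0 (proj_exists v y n0)). Qed.

Definition slope y : V := hull_proj ((1 - q) *: y).

Lemma slopeP y : is_proj n v ((1 - q) *: y) (slope y).
Proof. exact: hull_projP. Qed.

(* The Moreau envelope of the support function of the convex hull of the [v_j]. *)
Definition moreau y : R := dot (slope y) y - dot (slope y) (slope y) / (2 * (1 - q)).

Definition envelope y : R := q / 2 * dot y y + moreau y.

Let q'0 : 0 < 1 - q. Proof. by rewrite subr_gt0. Qed.

(** With [p = slope y], the right side minus the left is [(|s - p|^2 - 2 <(1 - q) y - p, s - p>) /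
    (2 (1 - q))]. *)
Lemma moreau_ge s y : dot ((1 - q) *: y - slope y) (s - slope y) <= 0 ->
  dot s y - dot s s / (2 * (1 - q)) <= moreau y.
Proof.
rewrite /moreau; move: (slope y) => p H.
have q2 : 0 < 2 * (1 - q) by rewrite mulr_gt0.
rewrite -(ler_pM2l q2) ![_ * (dot _ _ - _)]mulrBr !(mulrC _ (_ / _)) !divfK ?gt_eqF//.
have := dot_ge0 (s - p); move: H; rewrite !dotE !(dotC y) !(dotC p s); lra.
Qed.

Lemma moreau_ge_vertex j y : (j < n)%N ->
  dot (v j) y - dot (v j) (v j) / (2 * (1 - q)) <= moreau y.
Proof. by move=> jn; apply: moreau_ge; have [_] := slopeP y; apply. Qed.

(** The slope at [y] lies in the hull, so it competes in the maximum defining the envelope at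
    [y + u]. *)
Lemma moreau_subgradient y u : moreau y + dot (slope y) u <= moreau (y + u).
Proof.
have [[w sw wE] _] := slopeP y.
have := moreau_ge (is_proj_le (slopeP (y + u)) sw).
by rewrite -wE dotDr => H; rewrite [moreau y]/moreau; lra.
Qed.

Lemma slope_monotone y u :
  dot (slope (y + u) - slope y) (slope (y + u) - slope y) <=
  (1 - q) * dot u (slope (y + u) - slope y).
Proof.
have := proj_nonexpansive (slopeP y) (slopeP (y + u)).
by rewrite -scalerBr addrAC subrr add0r dotZl.
Qed.

(** Use the subgradient inequality backwards from [y + u]; the change of slope is controlled by
    [slope_monotone] and a completed square. *)
Lemma moreau_quadratic y u :
  moreau (y + u) <= moreau y + dot (slope y) u + (1 - q) * dot u u.
Proof.
have := moreau_subgradient (y + u) (- u); rewrite addrK dotNr.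
have aux s : dot s s <= (1 - q) * dot u s -> dot s u <= (1 - q) * dot u u.
  rewrite -[_ <= (1 - q) * dot u u](ler_pM2l q'0).
  by have := dot_ge0 (s - (1 - q) *: u); rewrite !dotE (dotC u s); lra.
have := aux _ (slope_monotone y u); rewrite dotBl; lra.
Qed.

Lemma slope_lipschitz y y' : l2norm (slope y' - slope y) <= (1 - q) * l2norm (y' - y).
Proof.
have := slope_monotone y (y' - y); rewrite [y + _]addrC subrK -l2norm_sq => H.
have [->|D0] := eqVneq (l2norm (slope y' - slope y)) 0.
  by rewrite mulr_ge0 ?l2norm_ge0// ltW.
have Dp : 0 < l2norm (slope y' - slope y) by rewrite lt0r D0 l2norm_ge0.
rewrite -(ler_pM2r Dp) -expr2 (le_trans H)// -mulrA ler_pM2l//.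
exact: dot_le_l2norm.
Qed.

Lemma moreau_convex x y t : 0 <= t <= 1 ->
  moreau (t *: x + (1 - t) *: y) <= t * moreau x + (1 - t) * moreau y.
Proof.
move=> /andP[t0 t1]; set z := t *: x + _.
have Hx := moreau_subgradient z (x - z); have Hy := moreau_subgradient z (y - z).
rewrite [z + _]addrC subrK in Hx; rewrite [z + _]addrC subrK in Hy.
have t1' : 0 <= 1 - t by rewrite subr_ge0.
have := lerD (ler_wpM2l t0 Hx) (ler_wpM2l t1' Hy).
suff -> : t * (moreau z + dot (slope z) (x - z)) +
  (1 - t) * (moreau z + dot (slope z) (y - z)) = moreau z by [].
by rewrite !dotBr {2 4}/z !dotE; ring.
Qed.

Variables (L : R) (xs : V).
Hypothesis L0 : 0 < L.
Local Notation f := (fun x => L * envelope (x - xs)).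

Lemma envelope_gradient x : differentiable f x /\
  gradient f x = L *: (q *: (x - xs) + slope (x - xs)).
Proof.
apply: (quadratic_gradient (M := L * (q / 2 + (1 - q)))).
  by rewrite mulr_ge0 ?(ltW L0)// addr_ge0 ?divr_ge0// ltW.
move=> u; have -> : x + u - xs = x - xs + u by rewrite addrAC.
move: (x - xs) => y.
rewrite dotZl -mulrBr -mulrBr normrM gtr0_norm// -mulrA ler_pM2l//.
rewrite ger0_norm.
  have := moreau_quadratic y u; rewrite /envelope !dotE (dotC u y); lra.
have := moreau_subgradient y u; have : 0 <= q * dot u u by rewrite mulr_ge0 ?dot_ge0.
rewrite /envelope !dotE (dotC u y); lra.
Qed.

(** The quadratic term supplies the strong convexity; the Lipschitz constants [q] and [1 - q] of the
    two gradient parts add up to [1] before scaling by [L]. *)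
Lemma envelope_smooth_class : smooth_class (L * q) L f.
Proof.
split=> [x|x y t t01|x y].
- by have [] := envelope_gradient x.
- rewrite l2norm_sq.
  have -> : t *: x + (1 - t) *: y - xs = t *: (x - xs) + (1 - t) *: (y - xs).
    by apply/rowP => i; rewrite !mxE; ring.
  have -> : x - y = (x - xs) - (y - xs) by apply/rowP => i; rewrite !mxE; ring.
  have := ler_wpM2l (ltW L0) (moreau_convex (x - xs) (y - xs) t01).
  move: (x - xs) (y - xs) => a b.
  rewrite /envelope !dotE (dotC b a); lra.
- have [_ ->] := envelope_gradient x; have [_ ->] := envelope_gradient y.
  rewrite -scalerBr l2normZ ?(ltW L0)// ler_pM2l//.
  have -> : x - y = (x - xs) - (y - xs) by apply/rowP => i; rewrite !mxE; ring.
  move: (x - xs) (y - xs) => a b.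
  rewrite opprD addrACA -scalerBr (le_trans (l2norm_triangle _ _))//.
  rewrite l2normZ//; have := slope_lipschitz b a; lra.
Qed.

Hypothesis has0 : exists2 j, (j < n)%N & v j = 0.

Lemma envelope_ge0 y : 0 <= envelope y.
Proof.
have [j jn vj] := has0; have := moreau_ge_vertex y jn.
rewrite vj !dot0l mul0r subrr => h.
by rewrite addr_ge0// mulr_ge0 ?dot_ge0// divr_ge0.
Qed.

Lemma envelope0 : envelope 0 = 0.
Proof.
have [j jn vj] := has0; have [_ /(_ j jn)] := slopeP 0.
rewrite vj scaler0 sub0r dotNl dotNr opprK => p0.
rewrite /envelope /moreau !dot0r mulr0 !add0r.
have -> : dot (slope 0) (slope 0) = 0 by apply/eqP; rewrite eq_le p0 dot_ge0.
by rewrite mul0r oppr0.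
Qed.

Lemma envelope_argmin : argmin f xs.
Proof. by move=> y; rewrite subrr envelope0 mulr0 mulr_ge0 ?envelope_ge0// ltW. Qed.

Lemma envelope_min_value : min_value f = 0.
Proof.
apply/eqP; rewrite eq_le; apply/andP; split.
  apply: ge_inf; first by exists 0 => _ [y _ <-]; rewrite mulr_ge0 ?envelope_ge0// ltW.
  by exists xs => //; rewrite subrr envelope0 mulr0.
apply: lb_le_inf; first by exists (f xs); exists xs.
by move=> _ [y _ <-]; rewrite mulr_ge0 ?envelope_ge0// ltW.
Qed.

End Envelope.
Arguments slope {R d} q n v y.
Arguments envelope {R d} q n v y.

(** * The hard function *)

Section HardInstance.
Context {R : realType} {d : nat} {q : R} {N : nat} {D g dl m : nat -> R}.
Hypotheses (q0 : 0 <= q) (q1 : q < 1) (hc : hard_chain q N D g dl m).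
Local Notation V := 'rV[R]_d.
Implicit Types (E : nat -> V) (z u : V).

Definition orthonormal n E : Prop :=
  forall i j, (i < n)%N -> (j < n)%N -> dot (E i) (E j) = (i == j)%:R.

Definition frame_sum n (a : nat -> R) E : V := \sum_(0 <= l < n) a l *: E l.

Definition start E : V := frame_sum N.+1 D E.
(** This is [s_j + q y_0], the part of the slope that involves [e_0, ..., e_j] only. *)
Definition lifted_slope E j : V := g j *: E j + q *: frame_sum j dl E.
(** Index [N + 1] carries the vertex [0], so the hull is that of [N + 2] points. *)
Definition hard_slope E j : V :=
  if (j <= N)%N then lifted_slope E j - q *: start E else 0.

Lemma dot_frame_sum n a E z :
  dot z (frame_sum n a E) = \sum_(0 <= l < n) a l * dot z (E l).
Proof. by rewrite dot_sumr; apply: eq_bigr => i _; rewrite dotZr. Qed.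

Lemma dot_frame n a E l : orthonormal N.+1 E -> (n <= N.+1)%N -> (l <= N)%N ->
  dot (E l) (frame_sum n a E) = if (l < n)%N then a l else 0.
Proof.
move=> oE nN lN; rewrite dot_frame_sum.
transitivity (\sum_(0 <= i < n | i == l) a i); last by rewrite big_nat1_eq.
rewrite [RHS]big_mkcond; apply: eq_big_nat => i /andP[_ iN].
rewrite oE ?ltnS//; last exact: leq_trans iN nN.
by rewrite eq_sym; case: eqP; rewrite ?mulr1 ?mulr0.
Qed.

Lemma dot_frame_sums n a b E : orthonormal N.+1 E -> (n <= N.+1)%N ->
  dot (frame_sum n a E) (frame_sum n b E) = \sum_(0 <= l < n) a l * b l.
Proof.
move=> oE nN; rewrite dotC dot_frame_sum [RHS]big_nat [LHS]big_nat.
apply: eq_bigr => l /andP[_ ln].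
by rewrite dotC dot_frame ?ln 1?mulrC//; exact: leq_trans ln nN.
Qed.

Lemma dot_start E l : orthonormal N.+1 E -> (l <= N)%N -> dot (E l) (start E) = D l.
Proof. by move=> oE lN; rewrite dot_frame// ltnS lN. Qed.

Lemma dot_start_start E : orthonormal N.+1 E ->
  dot (start E) (start E) = \sum_(0 <= l < N.+1) D l ^+ 2.
Proof.
by move=> oE; rewrite dot_frame_sums.
Qed.

Lemma dot_lifted_slope E z j :
  dot z (lifted_slope E j) =
  slope_form (q := q) (g := g) (dl := dl) (fun l => dot z (E l)) j.
Proof. by rewrite dotDr !dotZr dot_frame_sum. Qed.

Lemma dot_start_lifted_slope E j : orthonormal N.+1 E -> (j <= N)%N ->
  dot (start E) (lifted_slope E j) =
  slope_form (q := q) (g := g) (dl := dl) D j.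
Proof.
move=> oE jN; rewrite dot_lifted_slope /slope_form; congr (_ * _ + q * _).
  by rewrite dotC dot_start.
apply: eq_big_nat => l /andP[_ lj].
rewrite dotC dot_start//; exact: leq_trans (ltnW lj) jN.
Qed.

Lemma dot_frame_lifted_slope E i l : orthonormal N.+1 E -> (i <= l <= N)%N ->
  dot (E l) (lifted_slope E i) = if i == l then g i else 0.
Proof.
move=> oE /andP[il lN]; rewrite /lifted_slope dotDr !dotZr dot_frame//; last first.
  exact: leqW (leq_trans il lN).
rewrite ltnNge il mulr0 addr0 oE ?ltnS//; last exact: leq_trans il lN.
by rewrite eq_sym; case: eqP; rewrite ?mulr1 ?mulr0.
Qed.

Lemma hard_slopeE E j : (j <= N)%N ->
  hard_slope E j = lifted_slope E j - q *: start E.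
Proof. by rewrite /hard_slope => ->. Qed.

Lemma comb_hard_slope k w E : simplex k.+1 w -> (k <= N)%N ->
  comb k.+1 w (hard_slope E) = comb k.+1 w (lifted_slope E) - q *: start E.
Proof.
move=> [_ w1] kN; rewrite /comb.
rewrite (eq_big_nat _ _ (F2 := fun i => w i *: lifted_slope E i -
    w i *: (q *: start E))); last first.
  move=> i /andP[_ ik]; rewrite hard_slopeE ?scalerBr//.
  exact: leq_trans (ik : (i <= k)%N) kN.
by rewrite sumrB -scaler_suml w1 scale1r.
Qed.

(* With [z] the residual of the projection, the slopes beyond [k] are dominated
   by [s_k] in direction [z] ([slope_form_dec]), and the vertex [0] by the convex
   combination of the slopes given by the multipliers ([slope_form_bound]). *)
Lemma hard_slope_zero_chain E k u p : orthonormal N.+1 E -> (k < N)%N ->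
  (forall l, (k <= l <= N)%N -> dot u (E l) = 0) ->
  is_proj k.+1 (hard_slope E) ((1 - q) *: (start E + u)) p ->
  is_proj N.+2 (hard_slope E) ((1 - q) *: (start E + u)) p.
Proof.
move=> oE kN uE [[w sw pE] hp]; have kN' := ltnW kN.
have [w0 w1] := sw.
set z := _ - p in hp *.
have zE l : (k <= l <= N)%N ->
    dot z (E l) = D l - if l == k then w k * g k else 0.
  move=> /andP[kl lN]; rewrite /z pE comb_hard_slope// opprB.
  rewrite !dotE uE ?kl// (dotC (start E)) dot_start// (dotC _ (E l)) dot_comb.
  have -> : \sum_(0 <= i < k.+1) w i * dot (E l) (lifted_slope E i) =
            if l == k then w k * g k else 0.
    rewrite big_nat_recr//= big_nat big1 ?add0r; last first.
      move=> i /andP[_ ik]; rewrite dot_frame_lifted_slope//.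
        by rewrite ltn_eqF ?mulr0//; exact: leq_trans ik kl.
      by rewrite lN andbT; exact: leq_trans (ltnW ik) kl.
    rewrite dot_frame_lifted_slope ?kl// eq_sym.
    by case: eqP; rewrite ?mulr0.
  by ring.
have wk : w k <= 1.
  rewrite -w1 big_nat_recr//= lerDr.
  by apply: sumr_ge0 => i _; exact: w0.
have slopes j : (j <= N)%N -> dot z (hard_slope E j - p) <= 0.
  move=> jN; have [jk|kj] := leqP j k; first exact: hp.
  have := hp k (leqnn _); rewrite !hard_slopeE// !dotBr !dot_lifted_slope => hk.
  have dec : slope_form (q := q) (g := g) (dl := dl) (fun l => dot z (E l)) j <=
             slope_form (q := q) (g := g) (dl := dl) (fun l => dot z (E l)) k.
    apply: (slope_form_dec hc kN) => [l /andP[kl lN]||]; last by rewrite (ltnW kj).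
      by rewrite zE ?lN ?(ltnW kl)// gtn_eqF// subr0.
    rewrite zE ?leqnn// eqxx lerD2l lerN2 -[leRHS]mul1r ler_wpM2r//.
    by rewrite ltW// (hc_g_gt0 hc).
  by move: hk dec; lra.
split.
  exists (fun i => if (i <= k)%N then w i else 0).
    split=> [i|]; first by case: ifP.
    rewrite (big_cat_nat _ (n := k.+1))//=; last by rewrite ltnS leqW.
    rewrite -[RHS]w1 -[RHS]addr0; congr (_ + _).
      by apply: eq_big_nat => i /andP[_ ik]; rewrite -ltnS ik.
    by rewrite big_nat big1// => i /andP[ki _]; rewrite leqNgt ki.
  rewrite pE /comb [RHS](big_cat_nat _ (n := k.+1))//=; last by rewrite ltnS leqW.
  rewrite -[LHS]addr0; congr (_ + _).
    by apply: eq_big_nat => i /andP[_ ik]; rewrite -ltnS ik.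
  by rewrite big_nat big1// => i /andP[ki _]; rewrite leqNgt ki scale0r.
move=> j; rewrite ltnS leq_eqVlt => /predU1P[->|]; last exact: slopes.
rewrite /hard_slope ltnn sub0r dotNr oppr_le0.
have := @slope_form_bound _ _ _ _ _ _ _ hc (fun l => dot z (E l))
  (dot z p + q * dot z (start E)).
rewrite -(dot_frame_sum N.+1 D E z) lerDr; apply.
- move=> i iN; rewrite -dot_lifted_slope; have := slopes i iN.
  by rewrite hard_slopeE// !dotBr dotZr; lra.
- by rewrite zE ?leqnn ?kN'// gtn_eqF// subr0 ltW// (hc_D_gt0 hc).
Qed.

(** The frame enters the value only through inner products among [y_0], [W] and [u], which makes two
    frames comparable. *)
Lemma envelope_hardE E W u : 
  slope q N.+2 (hard_slope E) (start E + u) = W - q *: start E ->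
  envelope q N.+2 (hard_slope E) (start E + u) =
  (2 * (dot (start E) W) + 2 * (1 - q) * dot W u - dot W W
   - q * dot (start E) (start E)) / (2 * (1 - q)) + q / 2 * dot u u.
Proof.
move=> sE; rewrite /envelope /moreau sE !dotE (dotC W (start E)) (dotC u (start E)).
by field; rewrite gt_eqF ?subr_gt0.
Qed.

(** The projection is [W - q y_0] with [W] a combination of lifted slopes up to [k], common to both
    frames. In the gradient [y_0] cancels, leaving [q u + W]; in the value, [<y_0, W>] and [|y_0|^2]
    depend only on the chain and the weights. *)
Lemma hard_slope_consistent E E' k u : orthonormal N.+1 E -> orthonormal N.+1 E' ->
  (k < N)%N -> (forall l, (l <= k)%N -> E l = E' l) ->
  (forall l, (k <= l <= N)%N -> dot u (E l) = 0) ->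
  (forall l, (k <= l <= N)%N -> dot u (E' l) = 0) ->
  envelope q N.+2 (hard_slope E) (start E + u) =
    envelope q N.+2 (hard_slope E') (start E' + u) /\
  q *: (start E + u) + slope q N.+2 (hard_slope E) (start E + u) =
  q *: (start E' + u) + slope q N.+2 (hard_slope E') (start E' + u).
Proof.
move=> oE oE' kN EE' uE uE'; have kN' := ltnW kN.
have [p hp] := proj_exists (hard_slope E) ((1 - q) *: (start E + u)) (ltn0Sn k).
have lE i : (i <= k)%N -> lifted_slope E' i = lifted_slope E i.
  move=> ik; rewrite /lifted_slope EE'//; congr (_ + q *: _).
  apply: eq_big_nat => l /andP[_ li]; rewrite EE'//.
  exact: leq_trans (ltnW li) ik.
have [[w sw pE] hpj] := hp.
pose W := comb k.+1 w (lifted_slope E).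
have {}pE : p = W - q *: start E by rewrite pE comb_hard_slope.
have WE' : comb k.+1 w (lifted_slope E') = W.
  by apply: eq_big_nat => i /andP[_ ik]; rewrite lE.
have dl' i : (i <= k)%N ->
    dot (start E') (lifted_slope E i) = dot (start E) (lifted_slope E i).
  move=> ik; have iN : (i <= N)%N by apply: leq_trans ik kN'.
  by rewrite -{1}lE// !dot_start_lifted_slope.
have dW : dot (start E') W = dot (start E) W.
  by rewrite !dot_comb; apply: eq_big_nat => i /andP[_ ik]; rewrite dl'.
have hp' : is_proj k.+1 (hard_slope E') ((1 - q) *: (start E' + u)) (W - q *: start E').
  split; first by exists w; rewrite ?comb_hard_slope ?WE'.
  move=> j jk; have := hpj j jk.
  have jN : (j <= N)%N by apply: leq_trans (jk : (j <= k)%N) kN'.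
  have dT := dl' j jk; rewrite pE !hard_slopeE// lE//.
  move: (lifted_slope E j) dT => T dT.
  have ss : dot (start E') (start E') = dot (start E) (start E).
    by rewrite !dot_start_start.
  rewrite !dotE !(dotC _ (start _)) ?dT ?ss ?dW; lra.
have sE : slope q N.+2 (hard_slope E) (start E + u) = W - q *: start E.
  apply: (proj_unique (slopeP _ _)) => //; rewrite -pE.
  exact: hard_slope_zero_chain hp.
have sE' : slope q N.+2 (hard_slope E') (start E' + u) = W - q *: start E'.
  apply: (proj_unique (slopeP _ _)) => //.
  exact: hard_slope_zero_chain hp'.
split; last by rewrite sE sE' !scalerDr; apply/rowP => i; rewrite !mxE; ring.
have ss : dot (start E') (start E') = dot (start E) (start E).
  by rewrite !dot_start_start.
by rewrite (envelope_hardE sE) (envelope_hardE sE') dW ss.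
Qed.

(** The case [k = 0], [u = 0] of [hard_slope_zero_chain]: the hull of [s_0] alone is a point. *)
Lemma hard_slope_start E : orthonormal N.+1 E -> (0 < N)%N ->
  slope q N.+2 (hard_slope E) (start E) = g 0%N *: E 0%N - q *: start E.
Proof.
move=> oE N0.
have [p hp] :=
  proj_exists (hard_slope E) ((1 - q) *: (start E + 0)) (ltn0Sn 0).
have pE : p = g 0%N *: E 0%N - q *: start E.
  have [[w [w0 w1] ->] _] := hp; rewrite /comb big_nat1.
  rewrite big_nat1 in w1; rewrite w1 scale1r hard_slopeE// /lifted_slope.
  by rewrite /frame_sum big_geq// scaler0 addr0.
apply: (proj_unique (slopeP _ _)) => //; rewrite -pE -[start E]addr0.
by apply: hard_slope_zero_chain hp => // l _; rewrite dot0l.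
Qed.

Lemma envelope_start E : orthonormal N.+1 E -> (0 < N)%N ->
  2 * envelope q N.+2 (hard_slope E) (start E) =
  D 0%N ^+ 2 - ((D 0%N - g 0%N) ^+ 2 + q * \sum_(1 <= l < N.+1) D l ^+ 2) / (1 - q).
Proof.
move=> oE N0; rewrite -[start E]addr0.
rewrite (@envelope_hardE _ (g 0%N *: E 0%N)) ?addr0 ?hard_slope_start//.
rewrite !dot0r !dotE dot_start_start// oE// eqxx dotC dot_start// big_ltn// mulr1n.
by field; rewrite gt_eqF ?subr_gt0.
Qed.

(** With [s_N = g_N e_N - q Y], the vertex bound plus [q/2 |y|^2] equals [q/2 |y - Y|^2] plus a
    constant, because [<e_N, y> = D_N]. Dropping the square leaves half of the left side. *)
Lemma envelope_hard_ge E u : orthonormal N.+1 E -> dot u (E N) = 0 ->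
  D N ^+ 2 - ((D N - g N) ^+ 2 + q * \sum_(0 <= l < N) (D l - dl l) ^+ 2) / (1 - q)
  <= 2 * envelope q N.+2 (hard_slope E) (start E + u).
Proof.
move=> oE uN.
pose a l := if (l < N)%N then D l - dl l else D l.
have sN : hard_slope E N = g N *: E N - q *: frame_sum N.+1 a E.
  rewrite hard_slopeE// /lifted_slope -addrA -scalerBr -scalerN; congr (_ + _ *: _).
  rewrite -[LHS]opprB; congr (- _); rewrite /start /frame_sum.
  rewrite !big_nat_recr//= /a ltnn addrAC; congr (_ + _).
  rewrite -sumrB; apply: eq_big_nat => l /andP[_ lN].
  by rewrite lN scalerBl.
have := moreau_ge_vertex (v := hard_slope E) q1 (ltn0Sn N.+1) (start E + u)
  (ltnW (leqnn N.+2) : (N < N.+2)%N).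
have yN : dot (start E + u) (E N) = D N by rewrite dotDl uN addr0 dotC dot_start.
have YN : dot (frame_sum N.+1 a E) (E N) = D N by rewrite dotC dot_frame// ltnSn /a ltnn.
have YY : dot (frame_sum N.+1 a E) (frame_sum N.+1 a E) =
    \sum_(0 <= l < N) (D l - dl l) ^+ 2 + D N ^+ 2.
  rewrite dot_frame_sums// big_nat_recr//= /a ltnn; congr (_ + _).
  by apply: eq_big_nat => l /andP[_ ->]; rewrite expr2.
rewrite /envelope sN; move: (frame_sum N.+1 a E) YN YY {sN} => Y YN YY.
move: (start E + u) yN => y yN.
have := dot_ge0 (y - Y); rewrite !dotE YY oE// eqxx.
rewrite (dotC (E N)) yN (dotC (E N)) YN (dotC Y y).
move: (moreau _) (dot y y) (dot y Y) (\sum_(_ <= _ < _) _) => M yy yY S H2 H1.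
have q'0 : 0 < 1 - q by rewrite subr_gt0.
have q2 : 0 < 2 * (1 - q) by rewrite mulr_gt0.
have H3 := ler_wpM2l (ltW q2) H1.
rewrite mulrBr (mulrC _ (_ / _)) divfK ?gt_eqF// !mulr1n in H3.
have H4 := mulr_ge0 (mulr_ge0 (ltW q'0) q0) H2.
rewrite -(ler_pM2l q'0) mulrBr (mulrC _ (_ / _)) divfK ?gt_eqF//; lra.
Qed.

End HardInstance.

(** * The resisting oracle *)

Section OrthonormalSystems.
Context {R : realType} {d : nat}.
Local Notation V := 'rV[R]_d.

(** The matrix with the vectors of [s] as columns has fewer columns than rows, hence a nonzero left
    kernel. *)
Lemma unit_vector_orthogonal (s : seq V) : (size s < d)%N ->
  exists2 e : V, dot e e = 1 & forall x, x \in s -> dot e x = 0.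
Proof.
move=> sd; pose A := \matrix_(i < d, j < size s) (s`_j) 0 i.
have : kermx A != 0.
  rewrite kermx_eq0 /row_free neq_ltn; apply/orP; left.
  exact: leq_ltn_trans (rank_leq_col A) sd.
move=> /rowV0Pn[u /sub_kermxP uA u0].
have uu : 0 < dot u u.
  by rewrite lt0r dot_ge0 andbT; apply: contraNneq u0 => /dot_eq0 ->.
exists ((Num.sqrt (dot u u))^-1 *: u).
  by rewrite !dotE mulrA -expr2 exprVn sqr_sqrtr ?mulVf ?gt_eqF// ltW.
move=> x xs; rewrite dotZl; have js : (index x s < size s)%N by rewrite index_mem.
have /rowP/(_ (Ordinal js)) := uA; rewrite !mxE => E.
have -> : dot u x = 0.
  by rewrite -[RHS]E; apply: eq_bigr => i _; rewrite mxE nth_index.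
by rewrite mulr0.
Qed.

Lemma orthonormal_exists n (s : seq V) : (size s + n <= d)%N ->
  exists2 E : nat -> V, orthonormal n E &
    forall i x, (i < n)%N -> x \in s -> dot (E i) x = 0.
Proof.
elim: n => [|n IH] sd; first by exists (fun=> 0).
have [|E oE Es] := IH; first by apply: leq_trans sd; rewrite addnS.
have [|e ee es] := @unit_vector_orthogonal (s ++ map E (iota 0 n)).
  by rewrite size_cat size_map size_iota; rewrite addnS in sd.
have eE i : (i < n)%N -> dot e (E i) = 0.
  by move=> ni; apply: es; rewrite mem_cat map_f ?orbT// mem_iota.
have ltn_or i : (i < n.+1)%N -> i != n -> (i < n)%N.
  by rewrite ltnS leq_eqVlt => /orP[/eqP ->|//]; rewrite eqxx.
exists (fun i => if i == n then e else E i) => [i j iN jN|i x iN xs].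
  have [iE|ni] := eqVneq i n; have [jE|nj] := eqVneq j n.
  - by rewrite ee iE jE eqxx.
  - by rewrite eE ?ltn_or// iE eq_sym (negbTE nj).
  - by rewrite dotC eE ?ltn_or// jE (negbTE ni).
  - by rewrite oE ?ltn_or.
have [_|ni] := eqVneq i n; first by apply: es; rewrite mem_cat xs.
by apply: Es => //; apply: ltn_or.
Qed.

End OrthonormalSystems.

Section Histories.
Context {R : realType} {d : nat} (A : fo_algorithm R d) (x0 : 'rV[R]_d).
Implicit Types (O : oracle R d) (h : history R d).

(** The definition peels off the first query of a run; inductions on its length need the last
    one. *)
Lemma extend_historyS O k h : extend_history A O k.+1 h =
  let h' := extend_history A O k h in
  if next_query A h' is Some x then rcons h' (x, O x) else h'.
Proof.
elim: k h => [//|k IH] h.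
have unfold j : extend_history A O j.+1 h =
    if next_query A h is Some x then extend_history A O j (rcons h (x, O x))
    else h by [].
rewrite (unfold k.+1) (unfold k); case E : (next_query A h) => [x|].
  exact: IH.
by rewrite /= E.
Qed.

Definition hist O k : history R d := extend_history A O k [:: (x0, O x0)].

Lemma histS O k : hist O k.+1 =
  if next_query A (hist O k) is Some x then rcons (hist O k) (x, O x)
  else hist O k.
Proof. exact: extend_historyS. Qed.

Lemma hist_head O k : exists h, hist O k = (x0, O x0) :: h.
Proof.
elim: k => [|k [h IH]]; first by exists [::].
rewrite histS IH; case: (next_query _ _) => [x|]; last by exists h.
by exists (rcons h (x, O x)).
Qed.

(** A deterministic run depends on the oracle only through the answers it receives. *)
Lemma hist_agree O O' k :
  (forall e, e \in hist O k -> O e.1 = O' e.1) -> hist O' k = hist O k.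
Proof.
elim: k => [|k IH] OO.
  by rewrite /hist /= (OO (x0, O x0)) ?mem_seq1.
have {}IH : hist O' k = hist O k.
  apply: IH => e he; apply: OO; rewrite histS.
  by case: (next_query _ _) => // x; rewrite mem_rcons inE he orbT.
rewrite !histS IH; move: OO; rewrite histS; case: (next_query _ _) => // x OO.
by rewrite (OO (x, O x))// mem_rcons inE eqxx.
Qed.

End Histories.

Section ResistingOracle.
Context {R : realType} {d : nat} {q L : R} {N : nat} {D g dl m : nat -> R}.
Hypotheses (q0 : 0 <= q) (q1 : q < 1) (L0 : 0 < L) (N0 : (0 < N)%N).
Hypothesis hc : hard_chain q N D g dl m.
Hypothesis dN : (2 * N + 1 <= d)%N.
Variables (A : fo_algorithm R d) (x0 : 'rV[R]_d).
Local Notation V := 'rV[R]_d.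
Implicit Types (E : nat -> V).

Local Notation slopes E := (@hard_slope R d q N D g dl E).
Local Notation start E := (@start R d N D E).

Definition hard_function E (x : V) : R :=
  L * envelope q N.+2 (slopes E) (x - (x0 - start E)).

Lemma hard_function_shift E u :
  hard_function E (x0 + u) = L * envelope q N.+2 (slopes E) (start E + u).
Proof.
rewrite /hard_function; congr (_ * envelope _ _ _ _); move: (start E) => y.
by apply/rowP => i; rewrite !mxE; ring.
Qed.

Local Notation oracle_of E := (first_order_oracle (hard_function E)).

Lemma oracle_consistent E E' k x : orthonormal N.+1 E -> orthonormal N.+1 E' ->
  (k < N)%N -> (forall l, (l <= k)%N -> E l = E' l) ->
  (forall l, (k <= l <= N)%N -> dot (x - x0) (E l) = 0) ->
  (forall l, (k <= l <= N)%N -> dot (x - x0) (E' l) = 0) ->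
  oracle_of E x = oracle_of E' x.
Proof.
move=> oE oE' kN EE' xE xE'.
have [e1 e2] := hard_slope_consistent q1 hc oE oE' kN EE' xE xE'.
have sx F : x - (x0 - start F) = start F + (x - x0).
  by move: (start F) => y; apply/rowP => i; rewrite !mxE; ring.
have fE F : hard_function F x = L * envelope q N.+2 (slopes F) (start F + (x - x0)).
  by rewrite -sx.
have gE F : gradient (hard_function F) x =
    L *: (q *: (start F + (x - x0)) + slope q N.+2 (slopes F) (start F + (x - x0))).
  rewrite -sx.
  exact: (envelope_gradient (v := slopes F) q0 q1 (ltn0Sn N.+1) (x0 - start F) L0 x).2.
have ff := etrans (fE E) (etrans (congr1 ( *%R L) e1) (esym (fE E'))).
have gg := etrans (gE E) (etrans (congr1 (GRing.scale L) e2) (esym (gE E'))).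
exact: (f_equal2 pair ff gg).
Qed.

(** Query [i], counted from [0] at [x0], is orthogonal in displacement to [e_i, ..., e_N], so its
    answer reveals nothing beyond [e_i]. *)
Definition unseen E (h : history R d) : Prop :=
  orthonormal N.+1 E /\
  forall i l, (i < size h)%N -> (i <= l <= N)%N ->
    dot ((nth (x0, (0, 0)) h i).1 - x0) (E l) = 0.

Lemma size_hist O k : (size (hist A x0 O k) <= k.+1)%N.
Proof.
elim: k => [//|k IH]; rewrite histS; case: (next_query _ _) => [x|].
  by rewrite size_rcons ltnS.
exact: leqW.
Qed.

(* The basis vectors not yet revealed are replaced by vectors orthogonal to all
   the points of the history and to [x]; the answers given so far do not change. *)
Lemma unseen_refresh E k x h : hist A x0 (oracle_of E) k = h -> unseen E h ->
  (k < N)%N ->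
  exists E', [/\ hist A x0 (oracle_of E') k = h, unseen E' h &
    forall l, (size h <= l <= N)%N -> dot (x - x0) (E' l) = 0].
Proof.
move=> hh [oE hE] kN.
have tN : (size h <= N)%N by rewrite -hh; apply: leq_trans (size_hist _ _) kN.
have [h' hh'] : exists h', h = (x0, oracle_of E x0) :: h'.
  by rewrite -hh; exact: hist_head.
set t := size h in hE tN *.
have t0 : (0 < t)%N by rewrite /t hh'.
(* The new vectors avoid [x - x0], the [t] kept frame vectors and the [t - 1] displacements after
   the first, which is zero. These [2 t] vectors and [N + 1 - t] new ones fit, as
   [t + N + 1 <= 2 N + 1]. *)
pose s := (x - x0) :: map E (iota 0 t) ++ map (fun e => e.1 - x0) h'.
have sz : size s = (t + t)%N.
  have th : t = (size h').+1 by rewrite /t hh'.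
  by rewrite /= size_cat !size_map size_iota -addnS -th.
have [|F oF Fs] := @orthonormal_exists R d (N.+1 - t) s.
  rewrite sz -addnA subnKC; last exact: leqW.
  by apply: leq_trans dN; rewrite mul2n -addnn addn1 -addnS leq_add2r.
pose E' l := if (l < t)%N then E l else F (l - t)%N.
have EE' l : (l < t)%N -> E l = E' l by rewrite /E' => ->.
have FE l i : (t <= l <= N)%N -> (i < t)%N -> dot (F (l - t)%N) (E i) = 0.
  move=> /andP[tl lN] it; apply: Fs; first by rewrite ltn_sub2r// ltnS.
  by rewrite inE mem_cat map_f ?orbT// mem_iota.
have oE' : orthonormal N.+1 E'.
  move=> i j iN jN; rewrite /E'.
  have [it|ti] := ltnP i t; have [jt|tj] := ltnP j t.
  - exact: oE.
  - by rewrite dotC FE ?tj// ltn_eqF// (leq_trans it).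
  - by rewrite FE ?ti// gtn_eqF// (leq_trans jt).
  - by rewrite oF ?ltn_sub2r// eqn_sub2rE.
have hE' i l : (i < t)%N -> (i <= l <= N)%N ->
    dot ((nth (x0, (0, 0)) h i).1 - x0) (E' l) = 0.
  move=> it /andP[il lN]; have [lt|tl] := ltnP l t.
    by rewrite -EE'// hE// il.
  rewrite /E' ltnNge tl /= dotC; case: i it il => [|i] it il.
    by rewrite hh' /= subrr dot0r.
  apply: Fs; first by rewrite ltn_sub2r// ltnS.
  rewrite hh' /= inE mem_cat.
  by rewrite (map_f (fun e => e.1 - x0)) ?orbT// mem_nth//; move: it; rewrite /t hh'.
have histE : hist A x0 (oracle_of E') k = h.
  rewrite -[RHS]hh; apply: hist_agree => e; rewrite hh => eh.
  have it : (index e h < t)%N by rewrite index_mem.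
  have xe l : (index e h <= l <= N)%N -> dot (e.1 - x0) (E l) = 0.
    by move=> hl; have := hE _ _ it hl; rewrite nth_index.
  have xe' l : (index e h <= l <= N)%N -> dot (e.1 - x0) (E' l) = 0.
    by move=> hl; have := hE' _ _ it hl; rewrite nth_index.
  apply: (oracle_consistent oE oE' (leq_trans it tN) _ xe xe').
  by move=> l li; apply: EE'; apply: leq_ltn_trans li it.
exists E'; split=> // l /andP[tl lN].
rewrite /E' ltnNge tl /= dotC; apply: Fs; first by rewrite ltn_sub2r// ltnS.
exact: mem_head.
Qed.

Lemma unseen_exists k : (k < N)%N ->
  exists E h, hist A x0 (oracle_of E) k = h /\ unseen E h.
Proof.
elim: k => [_|k IH kN].
  have [|E oE _] := @orthonormal_exists R d N.+1 [::].
    apply: leq_trans dN; rewrite mul2n -addnn addn1 ltnS.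
    exact: leq_addr.
  exists E, [:: (x0, oracle_of E x0)]; split; first by [].
  by split=> // -[|i] l //= _ _; rewrite subrr dot0l.
have [E [h [hh uE]]] := IH (ltnW kN).
case nq : (next_query A h) => [x|]; last first.
  by exists E, h; split=> //; rewrite histS hh nq.
have [E' [hh' [oE' hE'] xE']] := unseen_refresh x hh uE (ltnW kN).
exists E', (rcons h (x, oracle_of E' x)); split; first by rewrite histS hh' nq.
split=> // i l; rewrite size_rcons ltnS leq_eqVlt nth_rcons => /predU1P[->|it].
  by rewrite ltnn eqxx; exact: xE'.
by rewrite it; exact: hE'.
Qed.

(** The output is treated as one more query point. At most [N] points have been queried, so [e_N]
    can still be refreshed. *)
Lemma resisting_frame : exists2 E, orthonormal N.+1 E &
  dot (run N A (oracle_of E) x0 - x0) (E N) = 0.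
Proof.
have N1 : (N.-1 < N)%N by rewrite prednK.
have [E [h [hh uE]]] := unseen_exists N1.
have [E' [hh' [oE' _] xE']] := unseen_refresh (output A h) hh uE N1.
exists E' => //; rewrite /run -/(hist A x0 _ _) hh' xE'// leqnn andbT.
by rewrite -hh; apply: leq_trans (size_hist _ _) _; rewrite prednK.
Qed.

End ResistingOracle.

(** * Membership of the hard function in the problem class, and its gap *)

Section HardFunction.
Context {R : realType} {d : nat} {q L : R} {N : nat} {C : chain R} {m : nat -> R}.
Hypotheses (q0 : 0 <= q) (q1 : q < 1) (L0 : 0 < L) (N0 : (0 < N)%N).
Hypothesis hc : hard_chain q N (chain_D C) (chain_gamma C) (chain_delta C) m.
Variables (x0 : 'rV[R]_d) (E : nat -> 'rV[R]_d).
Hypothesis oE : orthonormal N.+1 E.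

Local Notation f := (hard_function (q := q) (L := L) (N := N) (D := chain_D C)
  (g := chain_gamma C) (dl := chain_delta C) x0 E).
Local Notation slopes := (hard_slope (q := q) (N := N) (D := chain_D C)
  (g := chain_gamma C) (dl := chain_delta C) E).
Local Notation y0 := (start (N := N) (D := chain_D C) E).

Let slopes_zero : exists2 j, (j < N.+2)%N & slopes j = 0.
Proof. by exists N.+1 => //; rewrite /hard_slope ltnn. Qed.

Lemma hard_function_min_value : min_value f = 0.
Proof. exact: (envelope_min_value q0 q1 (ltn0Sn N.+1) _ L0 slopes_zero). Qed.

Lemma hard_function_start : f x0 = L / 2 * init_Bf q N C.
Proof.
transitivity (L * envelope q N.+2 slopes (y0 + 0)).
  by rewrite -(hard_function_shift x0) addr0.
rewrite addr0 /init_Bf; by rewrite -(envelope_start q1 hc oE N0); field.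
Qed.

Lemma hard_function_gradient_start :
  gradient f x0 = L *: (chain_gamma C 0 *: E 0%N).
Proof.
have := (envelope_gradient (v := slopes) q0 q1 (ltn0Sn N.+1) (x0 - y0) L0 x0).2.
rewrite subKr (hard_slope_start hc oE N0) [q *: _ + _]addrC subrK.
exact.
Qed.

Lemma hard_function_class (wx wf wg rad : R) :
  wx * init_Bx N C + wf * init_Bf q N C + wg * init_Bg C <= rad ^+ 2 ->
  problem_class (L * q) L wx wf wg rad (f, x0).
Proof.
move=> W; split; first exact: (envelope_smooth_class q0 q1 (ltn0Sn N.+1) _ L0).
exists (x0 - y0).
  exact: (envelope_argmin q0 q1 (ltn0Sn N.+1) _ L0 slopes_zero).
rewrite [(f, x0).1]/= [(f, x0).2]/=.
rewrite hard_function_min_value hard_function_start hard_function_gradient_start.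
rewrite subKr !l2norm_sq dot_start_start// !dotE oE// eqxx.
apply: le_trans W; rewrite le_eqVlt; apply/orP; left; apply/eqP.
by rewrite /init_Bx /init_Bg mulr1n; field; rewrite gt_eqF.
Qed.

Lemma hard_function_gap x : dot (x - x0) (E N) = 0 ->
  L / 2 * cert_Phi q N C <= f x - min_value f.
Proof.
move=> xN; rewrite hard_function_min_value subr0 -(subrK x0 x) addrC.
rewrite hard_function_shift -mulrA ler_pM2l// ler_pdivrMl//.
exact: envelope_hard_ge.
Qed.

End HardFunction.

Theorem theorem5p4 (R : realType) (L mu : R) (N : nat) (wx wf wg eta : R)
    (hL : 0 < L) (hmu : 0 <= mu < L) (hN : (1 <= N)%N)
    (hwx : 0 <= wx) (hwf : 0 <= wf) (hwg : 0 <= wg)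
    (hw : wx + wf + wg = 1) (heta : 0 < eta)
    (hr : ordered_set (mu / L) N (induced_radius (mu / L) wx wf eta))
    (hH : 0 <= residual (mu / L) N wx wf eta) :
  (forall D0 : R, 0 < D0 ->
     candidate_chain_well_defined (mu / L) N wx wf eta D0 /\
     let C := candidate_chain (mu / L) N wx wf eta D0 in
     cert_Phi (mu / L) N C =
       eta * (wx * init_Bx N C + wf * init_Bf (mu / L) N C + wg * init_Bg C)
       + 2 * residual (mu / L) N wx wf eta
           * chain_gamma C 0 * (chain_D C 0 - chain_gamma C 0)) /\
  (forall (rad : R) (d : nat), 0 < rad -> (2 * N + 1 <= d)%N ->
     ((L / 2 * eta * rad ^+ 2)%:E <=
        minimax_risk N (problem_class (d := d) mu L wx wf wg rad))%E).
Proof.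
have hq : mu = L * (mu / L) by rewrite mulrC divfK// gt_eqF.
have q0 : 0 <= mu / L by rewrite divr_ge0 ?(ltW hL)//; case/andP: hmu.
have q1 : mu / L < 1 by rewrite ltr_pdivrMr// mul1r; case/andP: hmu.
have ident D0 : 0 < D0 -> _ :=
  fun hD => @certificate_identity _ _ wx wf wg eta N q0 q1 hN hwx heta hr hH D0 hD hw.
split=> [D0 hD0|rad d hrad hd].
  split; last exact: ident.
  exact: candidate_chain_wd.
move: hq q0 q1 hr hH ident; set q := mu / L => hq q0 q1 {}hr {}hH ident.
pose weight D0 := let C := candidate_chain q N wx wf eta D0 in
  wx * init_Bx N C + wf * init_Bf q N C + wg * init_Bg C.
have hc D0 (hD0 : 0 < D0) :=
  candidate_hard_chain q0 q1 hN hwx heta hr hH hD0.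
(* The three data are positive and the weights, being nonnegative with sum [1], cannot all
   vanish. *)
have weight_gt0 : 0 < weight 1.
  have Bx : 0 < init_Bx N (candidate_chain q N wx wf eta 1).
    rewrite /init_Bx big_ltn//= ltr_pwDl ?expr1n//.
    by apply: sumr_ge0 => l _; exact: sqr_ge0.
  have Bf := init_Bf_gt0 q1 hN (hc 1 ltr01).
  have Bg : 0 < init_Bg (candidate_chain q N wx wf eta 1).
    by rewrite exprn_gt0// (hc_g_gt0 (hc 1 ltr01)).
  have W0 : 0 <= weight 1.
    by rewrite /weight /= !addr_ge0// mulr_ge0// ltW.
  rewrite lt0r W0 andbT; apply/eqP => W1.
  have xx := mulr_ge0 hwx (ltW Bx); have yy := mulr_ge0 hwf (ltW Bf).
  have zz := mulr_ge0 hwg (ltW Bg); move: W1; rewrite /weight /= => W1.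
  have zero w B : 0 < B -> w * B = 0 -> w = 0 :> R.
    by move=> B0 /eqP; rewrite mulf_eq0 (gt_eqF B0) orbF => /eqP.
  have x1 : wx = 0 by apply: (zero _ _ Bx); lra.
  have x2 : wf = 0 by apply: (zero _ _ Bf); lra.
  have x3 : wg = 0 by apply: (zero _ _ Bg); lra.
  by move: hw; rewrite x1 x2 x3 !addr0 => /eqP; rewrite eq_sym oner_eq0.
(* The initial weight is homogeneous of degree two in [D_0], so [D_0 = t] meets the initial
   condition with equality. *)
pose t := rad / Num.sqrt (weight 1).
have t0 : 0 < t by rewrite divr_gt0// sqrtr_gt0.
have tW : weight t = rad ^+ 2.
  transitivity (t ^+ 2 * weight 1).
    rewrite -[t in LHS]mulr1 /weight /= init_Bx_scale// init_Bf_scale//.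
    by rewrite init_Bg_scale//; ring.
  by rewrite exprMn exprVn sqr_sqrtr ?(ltW weight_gt0)// divfK// gt_eqF.
have {}hc := hc t t0; have {}ident := ident t t0.
set C := candidate_chain q N wx wf eta t in hc ident.
have Phi_ge : eta * rad ^+ 2 <= cert_Phi q N C.
  rewrite ident -tW lerDl -mulrA mulr_ge0//; first by rewrite mulr_ge0.
  by rewrite mulr_ge0 ?subr_ge0 ?(hc_g_le hc)// ltW// (hc_g_gt0 hc).
apply: le_ereal_inf_tmp => _ [M [A hA] <-].
have [E oE EN] := resisting_frame q0 q1 hL hN hc hd A 0.
set f := hard_function _ _ in EN.
apply: (@le_trans _ _ (f (M (first_order_oracle f) 0) - min_value f)%:E).
  have gap := hard_function_gap (C := C) q0 q1 hL oE EN.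
  rewrite lee_fin hA; apply: (le_trans _ gap).
  by rewrite -mulrA ler_pM2l ?divr_gt0.
apply: ereal_sup_ubound; exists (f, 0) => //.
rewrite hq; apply: (hard_function_class q0 q1 hL hN hc 0 oE).
by rewrite -tW.
Qed.
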